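(* Under the setting and assumptions described in the context, $$\mathcal L^{*}=\sup\Big\{\mathcal L(f_1,\dots,f_K)\;:\; f_1,\dots,f_K\in\mathcal C(\mathcal Y),\ \textstyle\sum_{k=1}^K\lambda_k f_k\equiv 0 \text{ on } \mathcal Y\Big\}.$$
   Context: Let $K\ge 1$. For $k=1,\dots,K$ let $\mathcal X_k\subset\mathbb R^{D_k}$ be compact, and let $\mathcal Y\subset\mathbb R^{D}$ be compact with positive Lebesgue measure. Let $\mathbb P_k$ be an absolutely continuous Borel probability measure on $\mathcal X_k$. Let $c_k:\mathcal X_k\times\mathcal Y\to\mathbb R$ be continuous. Fix weights $\lambda_k>0$ with $\sum_k\lambda_k=1$ and fix $\epsilon>0$. $\mathcal P(\mathcal Y)$ denotes the Borel probability measures on $\mathcal Y$, and $\mathcal C(\mathcal Y)$ the continuous real functions on $\mathcal Y$. For $\mu\in\mathcal P(\mathcal Y)$, the differential entropy is $H(\mu)=-\int_{\mathcal Y}\log\frac{d\mu}{dy}(y)\,d\mu(y)$ if $\mu$ is absolutely continuous, and $H(\mu)=-\infty$ otherwise. For $\mathbb P$ on $\mathcal X$, $\mathbb Q\in\mathcal P(\mathcal Y)$ and a continuous cost $c$, let $\Pi(\mathbb P,\mathbb Q)$ be the set of couplings. Define $$\mathrm{EOT}_{c,\epsilon}(\mathbb P,\mathbb Q)=\min_{\pi\in\Pi(\mathbb P,\mathbb Q)}\Big\{\int c\,d\pi-\epsilon\int_{\mathcal X}H(\pi(\cdot\mid x))\,d\mathbb P(x)\Big\},$$ where $\pi(\cdot\mid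 x)$ is the conditional distribution of $\pi$ given the first coordinate. The barycenter value is $$\mathcal L^*=\inf_{\mathbb Q\in\mathcal P(\mathcal Y)}\sum_{k=1}^K\lambda_k\,\mathrm{EOT}_{c_k,\epsilon}(\mathbb P_k,\mathbb Q).$$ It is assumed that this infimum is finite for at least one $\mathbb Q$. For $f\in\mathcal C(\mathcal Y)$, the weak entropic $c_k$-transform is $$f^{C_k}(x)=\inf_{\mu\in\mathcal P(\mathcal Y)}\Big\{\int c_k(x,y)\,d\mu(y)-\epsilon H(\mu)-\int f\,d\mu\Big\}.$$ This equals $-\epsilon\log Z_{c_k}(f,x)$, where $$Z_{c_k}(f,x)=\int_{\mathcal Y}\exp\Big(\frac{f(y)-c_k(x,y)}{\epsilon}\Big)\,dy.$$ Define $$\mathcal L(f_1,\dots,f_K)=\sum_{k=1}^K\lambda_k\int_{\mathcal X_k}f_k^{C_k}(x_k)\,d\mathbb P_k(x_k).$$ *)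

(* Defs.v *)
From HB Require Import structures.
From mathcomp Require Import all_boot all_order all_algebra.
From mathcomp Require Import all_classical all_reals all_analysis measurable_realfun.
Set Implicit Arguments.
Unset Strict Implicit.
Unset Printing Implicit Defensive.
Import Order.TTheory GRing.Theory Num.Theory.
Import numFieldNormedType.Exports.
Local Open Scope classical_set_scope.
Local Open Scope ring_scope.

Definition Rn (R : realType) (n : nat) :=
  g_sigma_algebraType (@open 'rV[R]_n).

(* Characterization of the Lebesgue measure on the Borel sets of R^n:
   it is the (unique, sigma-finite) measure giving every closed box its volume. *)
Definition is_lebesgue (R : realType) (n : nat)
    (leb : {measure set (Rn R n) -> \bar R}) : Prop :=
  forall a b : 'rV[R]_n, (forall i, a ord0 i <= b ord0 i) ->
    leb [set v : Rn R n | forall i, a ord0 i <= v ord0 i <= b ord0 i] =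
    (\prod_(i < n) (b ord0 i - a ord0 i))%:E.

Local Open Scope ereal_scope.

(* Differential entropy H(mu) w.r.t. the Lebesgue measure leb:
   -\int log (dmu/dy) dmu if mu is absolutely continuous, -oo otherwise.
   Since the density is unique leb-a.e., the value -\int log f dmu is the same
   for every density f; taking the sup over the (possibly empty) set of
   densities gives exactly that value, and -oo (sup of the empty set)
   when mu has no density. *)
Definition is_density (R : realType) (n : nat)
    (leb : {measure set (Rn R n) -> \bar R})
    (mu : probability (Rn R n) R) (f : Rn R n -> R) : Prop :=
  [/\ measurable_fun setT f, (forall y, (0 <= f y)%R) &
      forall A, measurable A -> mu A = \int[leb]_(y in A) (f y)%:E].

Definition entropy (R : realType) (n : nat)
    (leb : {measure set (Rn R n) -> \bar R})
    (mu : probability (Rn R n) R) : \bar R :=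
  ereal_sup [set - (\int[mu]_y (ln (f y))%:E) | f in is_density leb mu].

Definition coupling_disint (R : realType) (m n : nat)
    (P : probability (Rn R m) R) (Q : probability (Rn R n) R)
    (pi : probability (Rn R m * Rn R n)%type R)
    (kappa : Rn R m -> probability (Rn R n) R) : Prop :=
  [/\ (forall B, measurable B -> measurable_fun [set: Rn R m] (kappa ^~ B)),
      (forall A B, measurable A -> measurable B ->
         pi (A `*` B) = \int[P]_(x in A) kappa x B) &
      (forall B, measurable B -> pi (setT `*` B) = Q B)].

Definition EOT (R : realType) (m n : nat)
    (leb : {measure set (Rn R n) -> \bar R})
    (X : set 'rV[R]_m) (Y : set 'rV[R]_n)
    (c : 'rV[R]_m -> 'rV[R]_n -> R) (eps : R)
    (P : probability (Rn R m) R) (Q : probability (Rn R n) R) : \bar R :=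
  ereal_inf [set z | exists (pi : probability (Rn R m * Rn R n)%type R)
                             (kappa : Rn R m -> probability (Rn R n) R),
     coupling_disint P Q pi kappa /\
     z = (\int[pi]_(p in (X `*` Y : set (Rn R m * Rn R n)%type))
                     (c p.1 p.2)%:E)
         - eps%:E * (\int[P]_(x in X) entropy leb (kappa x))].

Definition ctrans (R : realType) (m n : nat)
    (leb : {measure set (Rn R n) -> \bar R})
    (Y : set 'rV[R]_n) (c : 'rV[R]_m -> 'rV[R]_n -> R) (eps : R)
    (f : 'rV[R]_n -> R) (x : 'rV[R]_m) : \bar R :=
  ereal_inf [set (\int[mu]_(y in Y) (c x y)%:E) - eps%:E * entropy leb mu
                   - (\int[mu]_(y in Y) (f y)%:E)
            | mu in [set mu : probability (Rn R n) R | mu (~` Y) = 0]].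

(* Main.v *)
Require Import Defs.
From HB Require Import structures.
From mathcomp Require Import all_boot all_order all_algebra.
From mathcomp Require Import all_classical all_reals all_analysis measurable_realfun.
From mathcomp Require Import giry lra.
Set Implicit Arguments.
Unset Strict Implicit.
Unset Printing Implicit Defensive.
Import Order.TTheory GRing.Theory Num.Theory.
Import numFieldNormedType.Exports.
Local Open Scope classical_set_scope.
Local Open Scope ring_scope.

(** Write u = f / eps and a = c / eps, with a extended by 0 outside X x Y. By the
    Gibbs variational principle the c-transform of f is - eps Z u, where Z u x is
    the logarithm of the integral of exp (u - a x) over Y; integrating it against
    the disintegration of a coupling gives weak duality.

    For the converse, let W u y be the logarithm of the integral of
    exp (- a x y - Z u x) against P, so that exp (u + W u) is the density of the
    second marginal of the Gibbs coupling of u. The dual functional attains its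
    maximum on the compact (Tychonoff) set of families with sum lam_k u_k = 0
    that vanish at a base point and inherit twice the modulus of continuity of
    the costs. The Sinkhorn-like step u_k |-> sum_j lam_j W_j - W_k preserves this
    set up to constants and raises the dual value by at least
    eps (1 - int exp (sum_k lam_k W_k)), which is nonnegative by AM-GM. At a
    maximizer the equality case of AM-GM shows that the K marginal densities
    coincide, and the common marginal Q closes the duality gap. *)

(** * Bounded measurable functions and their integrals *)

Section bounded_measurable.
Context {d} {T : measurableType d} {R : realType}.
Implicit Types f g : T -> R.

(** Such functions are integrable against every finite measure and stable under sums, products,
    exponentials and sections, so that integrability costs nothing in the later computations. *)
Definition bdm f := measurable_fun setT f /\ exists M, forall x, `|f x| <= M.

Lemma bdm_cst (r : R) : bdm (fun _ => r).
Proof. by split; [exact: measurable_cst | exists `|r|]. Qed.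

Lemma bdmD f g : bdm f -> bdm g -> bdm (fun x => f x + g x).
Proof.
move=> [mf [M hM]] [mg [N hN]]; split; first exact: measurable_funD.
by exists (M + N) => x; rewrite (le_trans (ler_normD _ _))// lerD.
Qed.

Lemma bdmM f g : bdm f -> bdm g -> bdm (fun x => f x * g x).
Proof.
move=> [mf [M hM]] [mg [N hN]]; split; first exact: measurable_funM.
by exists (M * N) => x; rewrite normrM ler_pM.
Qed.

Lemma bdmZ r f : bdm f -> bdm (fun x => r * f x).
Proof. by move=> bf; apply: bdmM => //; exact: bdm_cst. Qed.

Lemma bdmN f : bdm f -> bdm (fun x => - f x).
Proof. by move=> /(bdmZ (-1)); under eq_fun do rewrite mulN1r. Qed.

Lemma bdmB f g : bdm f -> bdm g -> bdm (fun x => f x - g x).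
Proof. by move=> bf bg; apply: bdmD => //; exact: bdmN. Qed.

Lemma bdm_sum n (F : 'I_n -> T -> R) :
  (forall i, bdm (F i)) -> bdm (fun x => \sum_(i < n) F i x).
Proof.
move=> bF; suff: bdm (\sum_(i < n) F i).
  by congr bdm; apply/funext => x; rewrite fct_sumE.
elim/big_ind : _ => //; first exact: bdm_cst.
by move=> f g; exact: bdmD.
Qed.

Lemma bdm_expR f : bdm f -> bdm (fun x => expR (f x)).
Proof.
move=> [mf [M hM]]; split; first exact: measurableT_comp.
exists (expR M) => x; rewrite ger0_norm ?expR_ge0// ler_expR.
by rewrite (le_trans (ler_norm _)).
Qed.

Lemma bdm_restrict (A : set T) f : measurable A -> measurable_fun A f ->
  (exists M, forall x, A x -> `|f x| <= M) -> bdm (f \_ A).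
Proof.
move=> mA mf [M hM]; split.
  by apply/(measurable_restrictT _ mA).
exists (Num.max M 0) => x; rewrite patchE; case: ifPn => [/set_mem xA|_].
  by rewrite le_max hM.
by rewrite normr0 le_max lexx orbT.
Qed.

Lemma bdm_integrable (mu : {finite_measure set T -> \bar R}) f :
  bdm f -> mu.-integrable setT (EFin \o f).
Proof.
move=> [mf [M hM]]; apply: measurable_bounded_integrable => //.
  by rewrite ltey_eq fin_num_measure.
exists M; split; first exact: num_real.
by move=> r Mr x _; exact: le_trans (hM x) (ltW Mr).
Qed.

Lemma EFin_bdm_Rintegral (mu : {finite_measure set T -> \bar R}) f : bdm f ->
  (\int[mu]_x f x)%:E = (\int[mu]_x (f x)%:E)%E.
Proof. by move=> bf; rewrite fineK// integrable_fin_num// bdm_integrable. Qed.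

Lemma Rintegral_prob_cst (P : probability T R) r : \int[P]_x (fun=> r) x = r.
Proof.
rewrite Rintegral_cst//; apply: (etrans (congr1 ( *%R r \o fine) _)).
  exact: probability_setT.
by rewrite /= mulr1.
Qed.

Lemma Rintegral_sum (mu : {finite_measure set T -> \bar R}) n (F : 'I_n -> T -> R) :
  (forall i, bdm (F i)) ->
  \int[mu]_x (\sum_(i < n) F i x) = \sum_(i < n) \int[mu]_x F i x.
Proof.
move=> bF; apply: EFin_inj; rewrite EFin_bdm_Rintegral; last exact: bdm_sum.
under eq_integral do rewrite -sumEFin.
rewrite integral_sum//; last by move=> i; exact: (bdm_integrable _ (bF i)).
by rewrite -sumEFin; apply: eq_bigr => i _; rewrite EFin_bdm_Rintegral.
Qed.

End bounded_measurable.

Section bdm_product.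
Context {d1 d2} {S : measurableType d1} {T : measurableType d2} {R : realType}.

Lemma bdm_fst (f : S -> R) : bdm f -> bdm (fun p : S * T => f p.1).
Proof.
move=> [mf [M hM]]; split; first exact: (measurableT_comp mf).
by exists M.
Qed.

Lemma bdm_snd (f : T -> R) : bdm f -> bdm (fun p : S * T => f p.2).
Proof.
move=> [mf [M hM]]; split; first exact: (measurableT_comp mf).
by exists M.
Qed.

Lemma bdm_pair1 (f : S * T -> R) x : bdm f -> bdm (fun y => f (x, y)).
Proof.
move=> [mf [M hM]]; split; first exact: (measurableT_comp mf).
by exists M.
Qed.

Lemma bdm_pair2 (f : S * T -> R) y : bdm f -> bdm (fun x => f (x, y)).
Proof.
move=> [mf [M hM]]; split; first exact: (measurableT_comp mf).
by exists M.
Qed.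

Lemma Rintegral_fubini_tonelli (P : {finite_measure set S -> \bar R})
    (nu : {finite_measure set T -> \bar R}) (f : S * T -> R) :
  bdm f -> (forall p, 0 <= f p) ->
  \int[P]_x \int[nu]_y f (x, y) = \int[nu]_y \int[P]_x f (x, y).
Proof.
move=> bf f0; rewrite {1 3}/Rintegral; congr fine.
under eq_integral do rewrite (EFin_bdm_Rintegral nu (bdm_pair1 _ bf)).
under [RHS]eq_integral do rewrite (EFin_bdm_Rintegral P (bdm_pair2 _ bf)).
apply: (fubini_tonelli (fun p => (f p)%:E)) => //.
by apply/measurable_EFinP; case: bf.
Qed.

End bdm_product.

(** * Logarithms of exponential integrals *)

Section log_sum_exp.
Context {d} {T : measurableType d} {R : realType}.
Variable mu : {finite_measure set T -> \bar R}.
Hypothesis mu_gt0 : (0 < mu setT)%E.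
Implicit Types f g : T -> R.

(** The log-partition function, which is the convex conjugate of relative entropy with respect to
    [mu]. *)
Definition lse g : R := ln (\int[mu]_x expR (g x)).

Lemma Rintegral_expR_gt0 g : bdm g -> 0 < \int[mu]_x expR (g x).
Proof.
move=> bg; have [mg [M hM]] := bg.
have : \int[mu]_x (expR (- M)) <= \int[mu]_x expR (g x).
  apply: le_Rintegral => //.
  - exact/bdm_integrable/bdm_cst.
  - exact/bdm_integrable/bdm_expR.
  - by move=> x _; rewrite ler_expR; have := hM x; rewrite ler_norml => /andP[].
apply: lt_le_trans.
rewrite Rintegral_cst// mulr_gt0 ?expR_gt0// fine_gt0// mu_gt0/=.
by rewrite ltey_eq fin_num_measure.
Qed.

Lemma expR_lse g : bdm g -> expR (lse g) = \int[mu]_x expR (g x).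
Proof. by move=> bg; rewrite lnK// posrE Rintegral_expR_gt0. Qed.

Lemma lse_cst r : lse (fun _ => r) = r + ln (fine (mu setT)).
Proof.
rewrite /lse Rintegral_cst// lnM ?posrE ?expR_gt0// ?expRK//.
by rewrite fine_gt0// mu_gt0/= ltey_eq fin_num_measure.
Qed.

Lemma le_lse f g : bdm f -> bdm g -> (forall x, f x <= g x) -> lse f <= lse g.
Proof.
move=> bf bg fg; rewrite -ler_expR !expR_lse//; apply: le_Rintegral => //.
- exact/bdm_integrable/bdm_expR.
- exact/bdm_integrable/bdm_expR.
- by move=> x _; rewrite ler_expR.
Qed.

Lemma lseD r g : bdm g -> lse (fun x => g x + r) = lse g + r.
Proof.
move=> bg; apply: expR_inj; rewrite expRD !expR_lse//; last first.
  by apply: bdmD => //; exact: bdm_cst.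
rewrite -RintegralZr//; last exact/bdm_integrable/bdm_expR.
by apply: eq_Rintegral => x _; rewrite expRD.
Qed.

(** A monotone map that commutes with the addition of constants is nonexpansive for the sup norm. *)
Lemma lse_dist e f g : bdm f -> bdm g -> (forall x, `|f x - g x| <= e) ->
  `|lse f - lse g| <= e.
Proof.
have H f' g' : bdm f' -> bdm g' -> (forall x, `|f' x - g' x| <= e) ->
    lse f' - lse g' <= e.
  move=> bf bg fg; rewrite lerBlDl -lseD//; apply: le_lse => //.
    by apply: bdmD => //; exact: bdm_cst.
  by move=> x; have := fg x; rewrite ler_norml => /andP[_]; rewrite lerBlDl.
move=> bf bg fg; rewrite ler_norml H// andbT lerNl opprB H// => x.
by rewrite distrC.
Qed.

End log_sum_exp.

Section lse_parametric.
Context {d1 d2} {S : measurableType d1} {T : measurableType d2} {R : realType}.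

(** Measurability in the parameter comes from Fubini-Tonelli; the bound comes from comparison with
    the zero function, whose [lse] is the logarithm of the total mass. *)
Lemma bdm_lse1 (nu : {finite_measure set T -> \bar R}) (f : S * T -> R) :
  (0 < nu setT)%E -> bdm f -> bdm (fun x => lse nu (fun y => f (x, y))).
Proof.
move=> nu0 bf; have [mf [M hM]] := bf; split.
  apply: measurableT_comp => //; apply: measurableT_comp => //=.
  apply: (measurable_fun_fubini_tonelli_F (fun p => (expR (f p))%:E)).
    by apply/measurable_EFinP; case: (bdm_expR bf).
  by move=> x; rewrite lee_fin expR_ge0.
exists (M + `|ln (fine (nu setT))|) => x.
have := @lse_dist _ _ _ _ nu0 M (fun y => f (x, y)) (fun _ => 0)
  (bdm_pair1 _ bf) (bdm_cst 0).
rewrite lse_cst// add0r => /(_ _)/le_trans H.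
rewrite -lerBlDr (le_trans (lerB_dist _ _))// H// => y.
by rewrite subr0.
Qed.

Lemma bdm_lse2 (P : {finite_measure set S -> \bar R}) (f : S * T -> R) :
  (0 < P setT)%E -> bdm f -> bdm (fun y => lse P (fun x => f (x, y))).
Proof.
move=> P0 bf; have [mf [M hM]] := bf; split.
  apply: measurableT_comp => //; apply: measurableT_comp => //=.
  apply: (measurable_fun_fubini_tonelli_G (fun p => (expR (f p))%:E)).
    by apply/measurable_EFinP; case: (bdm_expR bf).
  by move=> x; rewrite lee_fin expR_ge0.
exists (M + `|ln (fine (P setT))|) => y.
have := @lse_dist _ _ _ _ P0 M (fun x => f (x, y)) (fun _ => 0)
  (bdm_pair2 _ bf) (bdm_cst 0).
rewrite lse_cst// add0r => /(_ _)/le_trans H.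
rewrite -lerBlDr (le_trans (lerB_dist _ _))// H// => x.
by rewrite subr0.
Qed.

End lse_parametric.

(** * Comparison of extended-real integrals *)

Section integral_comparison.
Context {d} {T : measurableType d} {R : realType}.
Variable mu : {measure set T -> \bar R}.
Implicit Types (D : set T) (f g : T -> \bar R).
Local Open Scope ereal_scope.

(* No measurability is assumed: the integral of a nonnegative function is a
   supremum over the simple functions below it. *)
Lemma le_integral_pointwise D f g : (forall x, D x -> f x <= g x) ->
  \int[mu]_(x in D) f x <= \int[mu]_(x in D) g x.
Proof.
move=> fg; rewrite integral_mkcond [leRHS]integral_mkcond.
have {fg} fg x : (f \_ D) x <= (g \_ D) x.
  by rewrite !patchE; case: ifPn => [/set_mem/fg|].
have le_ge0 (u v : T -> \bar R) : (forall x, 0 <= u x) -> (forall x, 0 <= v x) ->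
    (forall x, u x <= v x) -> \int[mu]_x u x <= \int[mu]_x v x.
  move=> u0 v0 uv; rewrite !ge0_integralTE//; apply: le_ereal_sup.
  by move=> _ [h hu <-]; exists h => // x; exact: le_trans (hu x) (uv x).
rewrite integralE [leRHS]integralE leeB//.
  by apply: le_ge0 => // x; rewrite !funeposE ge_max !le_max fg lexx/= orbT.
apply: le_ge0 => // x.
by rewrite !funenegE ge_max !le_max leeN2 fg lexx/= orbT.
Qed.

Lemma ae_le_integral f g : measurable_fun setT f -> measurable_fun setT g ->
  (\forall x \ae mu, f x <= g x) -> \int[mu]_x f x <= \int[mu]_x g x.
Proof.
move=> mf mg fg; rewrite integralE [leRHS]integralE leeB//.
  apply: ae_ge0_le_integral => //; [exact: measurable_funepos..|].
  apply: filterS fg => x fgx _.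
  by rewrite !funeposE ge_max !le_max fgx lexx/= orbT.
apply: ae_ge0_le_integral => //; [exact: measurable_funeneg..|].
apply: filterS fg => x fgx _.
by rewrite !funenegE ge_max !le_max leeN2 fgx lexx/= orbT.
Qed.

(** Meant for [f] the entropy of a conditional law, a supremum over densities whose dependence on
    the point is not known to be measurable. Raising [g] to [+oo] on the null set [N] gives a
    measurable function that dominates [f] everywhere and has an integral no larger than that of
    [g]. *)
Lemma ae_le_integral_nonmeasurable f g N : measurable N -> mu N = 0 ->
  measurable_fun setT g -> (forall x, ~ N x -> f x <= g x) ->
  \int[mu]_x f x <= \int[mu]_x g x.
Proof.
move=> mN N0 mg fg.
pose g' := fun x => if x \in N then +oo else g x.
have mg' : measurable_fun setT g'.
  apply: measurable_fun_ifT => //; apply: (measurable_fun_bool true).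
  rewrite setTI (_ : _ @^-1` _ = N)//.
  by apply/seteqP; split => x /= => [/set_mem|/mem_set].
apply: (@le_trans _ _ (\int[mu]_x g' x)).
  apply: le_integral_pointwise => x _; rewrite /g'.
  by case: ifPn => [_|/negP]; [rewrite leey|rewrite inE; exact: fg].
apply: ae_le_integral => //.
exists N; split => // x /=; rewrite /g'.
case: ifPn => [/set_mem//|_ h]; exfalso; exact: h.
Qed.

End integral_comparison.

(** * Change of measure through a density *)

Section density.
Context {d} {T : measurableType d} {R : realType}.
Implicit Types (m mu : {measure set T -> \bar R}) (f : T -> R).

Definition density m mu f :=
  [/\ measurable_fun setT f, (forall y, 0 <= f y) &
      forall A, measurable A -> mu A = (\int[m]_(y in A) (f y)%:E)%E].

Import HBNNSimple.

(** Monotone convergence along simple functions reduces the formula to indicators, where it is the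
    defining property of a density. *)
Lemma ge0_integral_density m mu f (h : T -> \bar R) : density m mu f ->
  measurable_fun setT h -> (forall x, 0 <= h x)%E ->
  (\int[mu]_x h x = \int[m]_x (h x * (f x)%:E))%E.
Proof.
move=> [mf f0 fE] mh h0.
have mfE : measurable_fun setT (EFin \o f) by exact/measurable_EFinP.
pose g := nnsfun_approx measurableT mh.
have hE x : h x = lim ((EFin \o g n) x @[n --> \oo]).
  by apply/esym/cvg_lim => //; exact: cvg_nnsfun_approx.
have -> : (\int[mu]_x h x =
    lim (\int[mu]_x (EFin \o g n) x @[n --> \oo]))%E.
  under eq_integral => x _ do rewrite hE.
  apply: monotone_convergence => //.
  - by move=> n; apply/measurable_EFinP.
  - by move=> n x _ /=; rewrite lee_fin.
  - by move=> x _ a b ab; rewrite lee_fin; exact/lefP/nd_nnsfun_approx.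
have -> : (\int[m]_x (h x * (f x)%:E) =
    lim (\int[m]_x ((EFin \o g n) x * (f x)%:E) @[n --> \oo]))%E.
  have hfE x : (h x * (f x)%:E = lim ((EFin \o g n) x * (f x)%:E @[n --> \oo]))%E.
    by apply/esym/cvg_lim => //; apply: cvgeZr => //; exact: cvg_nnsfun_approx.
  under eq_integral => x _ do rewrite hfE.
  apply: monotone_convergence => [//| | |].
  - by move=> n; apply/emeasurable_funM => //; exact/measurable_EFinP.
  - by move=> n x _ /=; rewrite mule_ge0 ?lee_fin.
  - move=> x _ a b ab/=; rewrite lee_wpmul2r ?lee_fin//.
    exact/lefP/nd_nnsfun_approx.
suff suf n : (\int[m]_x ((EFin \o g n) x * (f x)%:E) =
    \int[mu]_x (EFin \o g n) x)%E by under [in RHS]eq_fun do rewrite suf.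
transitivity (\int[mu]_x
   (\sum_(y \in range (g n)) (y * \1_(g n @^-1` [set y]) x)%:E))%E; last first.
  by apply: eq_integral => t _; rewrite /= fimfunE -fsumEFin.
have indich k r : measurable_fun [set: T] (fun x => (r * \1_(g k @^-1` [set r]) x)%:E).
  by apply: (measurable_comp measurableT) => //; exact: measurable_funM.
rewrite ge0_integral_fsum//; last by move=> k y _; exact: nnfun_muleindic_ge0.
transitivity (\int[m]_x (\sum_(y \in range (g n))
    ((y * \1_(g n @^-1` [set y]) x)%:E * (f x)%:E)))%E.
  apply: eq_integral => x _.
  rewrite -ge0_mule_fsuml => [|y]; last exact: nnfun_muleindic_ge0.
  by rewrite fsumEFin // -(fimfunE _ x).
rewrite ge0_integral_fsum//; last 2 first.
  - by move=> y; apply: emeasurable_funM.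
  - move=> k y _; apply: mule_ge0; last by rewrite lee_fin.
    by rewrite EFinM; exact: nnfun_muleindic_ge0.
apply: eq_fsbigr => r rhn.
have mr : measurable (g n @^-1` [set r]) by exact: measurable_funPTI.
have r0 : 0 <= r by move: rhn; rewrite inE => -[x _ <-].
under eq_integral do rewrite EFinM -muleA.
rewrite ge0_integralZl ?lee_fin//; last 2 first.
  - by apply: emeasurable_funM => //; exact/measurable_EFinP/measurable_indic.
  - by move=> x _; rewrite mule_ge0 ?lee_fin.
under [RHS]eq_integral do rewrite EFinM.
rewrite ge0_integralZl ?lee_fin//; last exact/measurable_EFinP/measurable_indic.
congr (_ * _)%E; rewrite integral_indic// setIT fE//.
under eq_integral do rewrite muleC.
rewrite [RHS]integral_mkcond; apply: eq_integral => x _.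
by rewrite epatch_indic.
Qed.

End density.

(** * The Gibbs variational principle *)

Section gibbs_variational_principle.
Context {d} {T : measurableType d} {R : realType}.
Variables (m : {measure set T -> \bar R}) (Y : set T).
Hypotheses (mY : measurable Y) (Yoo : (m Y < +oo)%E) (Y0 : (0 < m Y)%E).

(* The differential entropy of the statement, with an arbitrary reference
   measure in place of Lebesgue measure. *)
Definition entr (mu : {measure set T -> \bar R}) : \bar R :=
  ereal_sup [set (- (\int[mu]_y (ln (f y))%:E))%E | f in density m mu].

Let nu : {finite_measure set T -> \bar R} := mfrestr mY Yoo.

Lemma mfrestr_setT_gt0 : (0 < nu setT)%E.
Proof. by rewrite /nu/= /mfrestr /mrestr setTI. Qed.

Let nu0 := mfrestr_setT_gt0.

Lemma density_mfrestr : density m nu (\1_Y).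
Proof.
split => // A mA; rewrite integral_indic// setIC.
by rewrite /nu/= /mfrestr /mrestr.
Qed.

Lemma ge0_integral_mfrestr (h : T -> \bar R) : measurable_fun setT h ->
  (forall x, 0 <= h x)%E ->
  (\int[nu]_x h x = \int[m]_x (h x * (\1_Y x)%:E))%E.
Proof. by move=> mh h0; apply: ge0_integral_density => //; exact: density_mfrestr. Qed.

Lemma integral_setC_null (mu : {measure set T -> \bar R}) (h : T -> \bar R) :
  mu (~` Y) = 0%E -> measurable_fun setT h ->
  (\int[mu]_(y in Y) h y = \int[mu]_y h y)%E.
Proof.
move=> muY mh; rewrite integral_mkcond; apply: ae_eq_integral => //.
  by apply/(measurable_restrictT _ mY); exact: measurable_funTS.
exists (~` Y); split; [exact: measurableC|by []|].
move=> x /= hx Yx; apply: hx => _; rewrite patchE mem_set//.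
Qed.

(** Put [l = h - lse nu h], so that [exp l] has mass one under [nu]. If [f] is a density of [mu],
    the inequality [1 + t <= exp t] at [t = l - ln f] gives [ln f >= 1 + l - exp (l - ln f)], and
    the exponential integrates to at most 1 against [mu]. Only bounded functions and [q] are split
    under the integral, so [ln f] may fail to be integrable. *)
Lemma entr_le (mu : probability T R) (h : T -> R) :
  mu (~` Y) = 0%E -> bdm h ->
  (entr mu <= (lse nu h - \int[mu]_y h y)%:E)%E.
Proof.
move=> muY bh; apply: ub_ereal_sup => _ [f df <-].
have [mf f0 fE] := df.
pose l y := h y - lse nu h.
have bl : bdm l by apply: bdmB => //; exact: bdm_cst.
(* The ratio of the Gibbs density to [f], cut off outside [Y]. *)
pose q y := expR (l y - ln (f y)) * \1_Y y.
have q0 y : 0 <= q y by rewrite mulr_ge0 ?expR_ge0.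
have ml : measurable_fun setT (fun y => expR (l y - ln (f y))).
  apply: measurableT_comp => //; apply: measurable_funB; first by case: bl.
  exact: measurableT_comp.
have mq : measurable_fun setT q by apply: measurable_funM.
have mqE : measurable_fun setT (EFin \o q) by exact/measurable_EFinP.
have intg1 : (\int[nu]_y (expR (l y))%:E = 1)%E.
  rewrite -EFin_bdm_Rintegral; last exact: bdm_expR.
  rewrite -(expR_lse nu0 bl) /l.
  by rewrite (lseD nu0 (- lse nu h) bh) subrr expR0.
have intq : (\int[mu]_y (q y)%:E <= 1)%E.
  rewrite (ge0_integral_density df)//.
  rewrite -intg1 ge0_integral_mfrestr//; last first.
    by apply/measurable_EFinP; case: (bdm_expR bl).
  apply: le_integral_pointwise => x _; rewrite -!EFinM lee_fin /q.
  (* Where [f] vanishes, the default value of [ln] is harmless, since [q] is multiplied by [f]. *)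
  have [->|fx] := eqVneq (f x) 0; first by rewrite mulr0 mulr_ge0 ?expR_ge0.
  rewrite mulrAC ler_wpM2r// expRB lnK ?posrE ?lt_neqAle ?f0 1?eq_sym ?fx//.
  by rewrite divfK.
have iq : mu.-integrable setT (EFin \o q).
  apply/integrableP; split => //=.
  under eq_integral do rewrite ger0_norm//.
  by rewrite (le_lt_trans intq)// ltry.
have il1 : mu.-integrable setT (EFin \o (fun y => l y + 1)).
  by apply: bdm_integrable; apply: bdmD => //; exact: bdm_cst.
have : (\int[mu]_y (l y + 1 - q y)%:E <= \int[mu]_y (ln (f y))%:E)%E.
  apply: ae_le_integral.
  - apply/measurable_EFinP; apply: measurable_funB => //.
    by apply: measurable_funD => //; case: bl.
  - by apply/measurable_EFinP; exact: measurableT_comp.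
  exists (~` Y); split; [exact: measurableC|by []|].
  move=> x /=; apply: contra_not => Yx.
  rewrite lee_fin /q indicE mem_set// mulr1.
  by have := expR_ge1Dx (l x - ln (f x)); lra.
rewrite leeNl => /(le_trans _); apply.
under eq_integral do rewrite EFinB.
rewrite integralB//.
have -> : (\int[mu]_x (l x + 1)%:E = (\int[mu]_x h x - lse nu h + 1)%:E)%E.
  rewrite -EFin_bdm_Rintegral; last by apply: bdmD => //; exact: bdm_cst.
  rewrite RintegralD//; last 2 first.
  - exact: bdm_integrable.
  - exact/bdm_integrable/bdm_cst.
  rewrite RintegralB//; last 2 first.
  - exact: bdm_integrable.
  - exact/bdm_integrable/bdm_cst.
  by rewrite !Rintegral_prob_cst.
have : (\int[mu]_x (q x)%:E)%E \is a fin_num by exact: integrable_fin_num.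
move: intq; case: (\int[mu]_x (q x)%:E)%E => // r.
by rewrite !lee_fin => ? _; lra.
Qed.

(** Equality case of [entr_le]: on [Y], which carries [mu], the logarithm of the density is exactly
    [h - lse nu h]. *)
Lemma entr_gibbs (mu : probability T R) (h : T -> R) :
  mu (~` Y) = 0%E -> bdm h ->
  density m mu (fun y => expR (h y - lse nu h) * \1_Y y) ->
  entr mu = (lse nu h - \int[mu]_y h y)%:E.
Proof.
move=> muY bh df; apply/eqP; rewrite eq_le entr_le//=.
have bl : bdm (fun y => h y - lse nu h) by apply: bdmB => //; exact: bdm_cst.
apply: ereal_sup_ubound; exists (fun y => expR (h y - lse nu h) * \1_Y y) => //.
transitivity (- (\int[mu]_y (h y - lse nu h)%:E))%E.
  congr (- _)%E; apply: ae_eq_integral => //.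
  - by apply/measurable_EFinP; apply: measurableT_comp => //; case: df.
  - by apply/measurable_EFinP; case: bl.
  - exists (~` Y); split; [exact: measurableC|by []|].
    move=> x /= hx Yx; apply: hx => _.
    by rewrite indicE mem_set// mulr1 expRK.
rewrite -EFin_bdm_Rintegral// RintegralB//; last 2 first.
- exact: bdm_integrable.
- exact/bdm_integrable/bdm_cst.
by rewrite Rintegral_prob_cst -EFinN opprB.
Qed.

End gibbs_variational_principle.

(** * Probabilities constructed from densities *)

Section probability_of_density.
Context {d} {T : measurableType d} {R : realType}.
Variables (m : {measure set T -> \bar R}) (g : T -> R).
Hypotheses (mg : measurable_fun setT g) (g0 : forall x, 0 <= g x).
Hypothesis g1 : (\int[m]_x (g x)%:E = 1)%E.

Definition density_prob (A : set T) : \bar R := (\int[m]_(x in A) (g x)%:E)%E.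

Let density_prob0 : density_prob set0 = 0%E.
Proof. by rewrite /density_prob integral_set0. Qed.

Let density_prob_ge0 A : (0 <= density_prob A)%E.
Proof. by apply: integral_ge0 => x _; rewrite lee_fin. Qed.

Let density_prob_sigma_additive : semi_sigma_additive density_prob.
Proof.
apply: semi_sigma_additive_nng_induced; first exact/measurable_EFinP.
by move=> x; rewrite lee_fin.
Qed.

HB.instance Definition _ := isMeasure.Build _ _ _ density_prob
  density_prob0 density_prob_ge0 density_prob_sigma_additive.

Let density_prob_setT : density_prob setT = 1%E.
Proof. exact: g1. Qed.

HB.instance Definition _ :=
  Measure_isProbability.Build _ _ _ density_prob density_prob_setT.

Lemma ex_density_prob : exists mu : probability T R, density m mu g.
Proof. by exists density_prob; split. Qed.

End probability_of_density.

Section density_restriction.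
Context {d} {T : measurableType d} {R : realType}.
Variables (m : {measure set T -> \bar R}) (Y : set T).
Hypotheses (mY : measurable Y) (Yoo : (m Y < +oo)%E).

(** Gibbs measures are built over the finite restricted measure, whereas the entropy refers to [m];
    the indicator of [Y] translates between the two. *)
Lemma density_of_mfrestr (mu : {measure set T -> \bar R}) g :
  density (mfrestr mY Yoo) mu g -> density m mu (fun y => g y * \1_Y y).
Proof.
move=> [mg g0 gE]; split.
- exact: measurable_funM.
- by move=> y; rewrite mulr_ge0.
move=> A mA; rewrite gE// integral_mkcond ge0_integral_mfrestr//; last 2 first.
- by apply/(measurable_restrictT _ mA)/measurable_funTS/measurable_EFinP.
- by move=> x; rewrite patchE; case: ifP => // _; rewrite lee_fin.
rewrite [RHS]integral_mkcond; apply: eq_integral => x _; rewrite !patchE.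
by case: ifP => // _; rewrite mul0e.
Qed.

Lemma density_mfrestr_setC (mu : {measure set T -> \bar R}) g :
  density (mfrestr mY Yoo) mu g -> mu (~` Y) = 0%E.
Proof.
move=> /density_of_mfrestr[_ _ ->]; last exact: measurableC.
by apply: integral0_eq => x Yx; rewrite indicE memNset// mulr0.
Qed.

End density_restriction.

(** * Integration along a disintegration *)

Section disintegration.
Context {d1 d2} {S : measurableType d1} {T : measurableType d2} {R : realType}.
Variables (P : probability S R) (kappa : S -> probability T R).
Variable pi : probability (S * T)%type R.
Hypothesis mkappa : forall B, measurable B ->
  measurable_fun [set: S] (kappa ^~ B).
Hypothesis piE : forall A B, measurable A -> measurable B ->
  pi (A `*` B) = (\int[P]_(x in A) kappa x B)%E.

(** The product of the Dirac mass at [x] and [kappa x]. Binding [P] with this kernel in the Giry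
    monad recovers [pi]. *)
Let section_kernel (x : S) : giry (S * T)%type R :=
  giry_prod (giry_ret x : giry S R, kappa x : giry T R).

Let measurable_section_kernel : measurable_fun setT section_kernel.
Proof.
apply: (measurableT_comp measurable_giry_prod) => /=.
apply/measurable_fun_pairP; split => /=; first exact: measurable_giry_ret.
exact: measurable_giry_codensity.
Qed.

Let giry_int_section_kernel (h : S * T -> \bar R) x : measurable_fun setT h ->
  (forall p, 0 <= h p)%E ->
  giry_int (section_kernel x) h = (\int[kappa x]_y h (x, y))%E.
Proof.
move=> mh h0; rewrite giry_int_prod1// giry_int_ret//.
exact: (@measurable_fun_fubini_tonelli_F _ _ _ _ _ (kappa x)).
Qed.

Lemma measurable_integral_disint (h : S * T -> \bar R) : measurable_fun setT h ->
  (forall p, 0 <= h p)%E ->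
  measurable_fun setT (fun x => \int[kappa x]_y h (x, y))%E.
Proof.
move=> mh h0; apply: (eq_measurable_fun (fun x => giry_int (section_kernel x) h)).
  by move=> x _; exact: giry_int_section_kernel.
exact: (measurableT_comp (measurable_giry_int mh h0)).
Qed.

(** By [piE] the Giry bind and [pi] agree on measurable rectangles, a generating class stable under
    intersection, hence they agree as measures. *)
Lemma ge0_integral_disint (h : S * T -> \bar R) : measurable_fun setT h ->
  (forall p, 0 <= h p)%E ->
  (\int[pi]_p h p = \int[P]_x \int[kappa x]_y h (x, y))%E.
Proof.
move=> mh h0; pose b := giry_bind (P : giry S R) measurable_section_kernel.
have bE f : measurable_fun setT f -> (forall p, 0 <= f p)%E ->
    (\int[b]_p f p = \int[P]_x \int[kappa x]_y f (x, y))%E.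
  move=> mf f0; rewrite -[LHS]/(giry_int b f) giry_int_bind//.
  by apply: eq_integral => x _; exact: giry_int_section_kernel.
rewrite -bE//; apply: eq_measure_integral => E mE _.
apply: (@measure_unique _ _ _
  [set A `*` B | A in @measurable _ S & B in @measurable _ T] (fun=> setT)) => //.
- by rewrite measurable_prod_measurableType.
- move=> _ _ [A1 mA1 [A2 mA2 <-]] [B1 mB1 [B2 mB2 <-]].
  exists (A1 `&` B1); first exact: measurableI.
  exists (A2 `&` B2); first exact: measurableI.
  by rewrite setXI.
- by move=> _; exists setT => //; exists setT => //; rewrite setXTT.
- by apply/seteqP; split => // x _; exists 0%N.
- move=> _ [A mA [B mB <-]]; apply: (etrans (piE mA mB)).
  have mAB : measurable (A `*` B) by exact: measurableX.
  transitivity (\int[b]_p (\1_(A `*` B) p)%:E)%E; last first.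
    by rewrite integral_indic// setIT.
  rewrite bE//; last exact/measurable_EFinP/measurable_indic.
  rewrite integral_mkcond; apply: eq_integral => x _; rewrite patchE.
  case: ifPn => [/set_mem xA|/negP xA].
    have -> : kappa x B = (\int[kappa x]_y (\1_B y)%:E)%E.
      by rewrite integral_indic// setIT.
    apply: eq_integral => y _.
    by congr EFin; rewrite !indicE; congr ((_ : bool)%:R);
      apply/idP/idP => [/set_mem|/set_mem[]] ?; rewrite inE.
  rewrite integral0_eq// => y _; rewrite indicE memNset// => -[/= + _].
  by move/mem_set.
- by move=> _; rewrite (le_lt_trans (probability_le1 _ _))// ltry.
Qed.

Lemma Rintegral_disint (h : S * T -> R) : bdm h ->
  bdm (fun x => \int[kappa x]_y h (x, y)) /\
  \int[pi]_p h p = \int[P]_x \int[kappa x]_y h (x, y).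
Proof.
move=> bh; have [mh [M hM]] := bh.
(* Adding the bound [M] makes the integrand nonnegative, which brings it within reach of
   [ge0_integral_disint]. *)
have bM : bdm (fun p => h p + M) by apply: bdmD => //; exact: bdm_cst.
have hM0 p : (0 <= (h p + M)%:E)%E.
  by rewrite lee_fin -lerBlDr sub0r; have := hM p; rewrite ler_norml => /andP[].
have mhM : measurable_fun setT (fun p => (h p + M)%:E).
  by apply/measurable_EFinP; case: bM.
have shift x : \int[kappa x]_y h (x, y) = \int[kappa x]_y (h (x, y) + M) - M.
  rewrite RintegralD//; last 2 first.
  - exact/bdm_integrable/bdm_pair1.
  - exact/bdm_integrable/bdm_cst.
  by rewrite Rintegral_prob_cst addrK.
have bint : bdm (fun x => \int[kappa x]_y (h (x, y) + M)).
  split.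
    by apply: measurableT_comp => //; exact: measurable_integral_disint mhM hM0.
  exists (M + M) => x; rewrite ger0_norm; last first.
    by apply: Rintegral_ge0 => y _; have := hM0 (x, y); rewrite lee_fin.
  rewrite -[leRHS](Rintegral_prob_cst (kappa x)); apply: le_Rintegral => //.
  - by apply: bdm_integrable; exact: bdm_pair1 bM.
  - exact/bdm_integrable/bdm_cst.
  - by move=> y _; rewrite lerD2r; exact: le_trans (ler_norm _) (hM _).
split.
  by under eq_fun do rewrite shift; apply: bdmB => //; exact: bdm_cst.
have -> : \int[pi]_p h p = \int[pi]_p (h p + M) - M.
  rewrite RintegralD//; last 2 first.
  - exact: bdm_integrable.
  - exact/bdm_integrable/bdm_cst.
  by rewrite Rintegral_prob_cst addrK.
under [RHS]eq_Rintegral do rewrite shift.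
rewrite RintegralB//; last 2 first.
- exact: bdm_integrable.
- exact/bdm_integrable/bdm_cst.
rewrite Rintegral_prob_cst; congr (_ - _); rewrite {1}/Rintegral.
rewrite ge0_integral_disint//; congr fine; apply: eq_integral => x _.
by rewrite EFin_bdm_Rintegral//; exact: bdm_pair1 bM.
Qed.

End disintegration.

(** * Potentials and the Gibbs coupling *)

Section potentials.
Context {d1 d2} {S : measurableType d1} {T : measurableType d2} {R : realType}.
Variables (P : probability S R) (nu : {finite_measure set T -> \bar R}).
Variable a : S -> T -> R.
Hypothesis nu0 : (0 < nu setT)%E.
Hypothesis ba : bdm (fun p : S * T => a p.1 p.2).
Implicit Types u v : T -> R.

Definition Zpot u (x : S) : R := lse nu (fun y => u y - a x y).
Definition Wpot u (y : T) : R := lse P (fun x => - a x y - Zpot u x).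
(** Up to the factor [- eps], the contribution of one marginal to the dual functional. *)
Definition logpart u : R := \int[P]_x Zpot u x.

Let P0 : (0 < P setT)%E.
Proof. by rewrite probability_setT. Qed.

Let bdm_expo u : bdm u -> bdm (fun p : S * T => u p.2 - a p.1 p.2).
Proof. by move=> bu; apply: bdmB => //; exact: bdm_snd. Qed.

Lemma bdm_Zpot u : bdm u -> bdm (Zpot u).
Proof. by move=> bu; exact: bdm_lse1 nu0 (bdm_expo bu). Qed.

Let bdm_expoW u : bdm u -> bdm (fun p : S * T => - a p.1 p.2 - Zpot u p.1).
Proof.
move=> bu; apply: bdmB; first exact: bdmN.
by apply: bdm_fst; exact: bdm_Zpot.
Qed.

Lemma bdm_Wpot u : bdm u -> bdm (Wpot u).
Proof. by move=> bu; exact: bdm_lse2 P0 (bdm_expoW bu). Qed.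

Lemma logpart_dist e u v : bdm u -> bdm v -> (forall y, `|u y - v y| <= e) ->
  `|logpart u - logpart v| <= e.
Proof.
move=> bu bv uv.
have Z x : `|Zpot u x - Zpot v x| <= e.
  apply: lse_dist => //; [exact: bdm_pair1 (bdm_expo bu)|
    exact: bdm_pair1 (bdm_expo bv)|].
  by move=> y; rewrite opprB addrA subrK.
rewrite -RintegralB//; [|exact/bdm_integrable/bdm_Zpot..].
have bZ : bdm (fun x => Zpot u x - Zpot v x) by apply: bdmB; exact: bdm_Zpot.
apply: (le_trans (le_normr_Rintegral _ _)) => //; first exact: bdm_integrable.
rewrite -[leRHS](Rintegral_prob_cst P); apply: le_Rintegral => //.
- apply: bdm_integrable; have [mZ [M hM]] := bZ.
  by split; [exact: measurableT_comp|exists M => x; rewrite normr_id].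
- exact/bdm_integrable/bdm_cst.
Qed.

Lemma logpartD r u : bdm u -> logpart (fun y => u y + r) = logpart u + r.
Proof.
move=> bu; rewrite -[in RHS](Rintegral_prob_cst P r) -RintegralD//; last 2 first.
- exact/bdm_integrable/bdm_Zpot.
- exact/bdm_integrable/bdm_cst.
apply: eq_Rintegral => x _; rewrite /Zpot -lseD//.
  by congr lse; apply/funext => y; rewrite addrAC.
exact: bdm_pair1 (bdm_expo bu).
Qed.

(** The modulus of continuity is that of the cost, whatever [u] is. This uniformity confines the
    dual problem to an equicontinuous set. *)
Lemma Wpot_dist e u y y' : bdm u -> (forall x, `|a x y - a x y'| <= e) ->
  `|Wpot u y - Wpot u y'| <= e.
Proof.
move=> bu ay; apply: lse_dist => //; [exact: bdm_pair2 (bdm_expoW bu)..|].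
move=> x; rewrite (_ : `|_| = `|a x y - a x y'|); first exact: ay.
by rewrite -normrN; congr (`|_|); lra.
Qed.

Lemma expR_Zpot u x : bdm u ->
  expR (Zpot u x) = \int[nu]_y expR (u y - a x y).
Proof. by move=> bu; rewrite expR_lse//; exact: bdm_pair1 (bdm_expo bu). Qed.

Lemma expR_Wpot u y : bdm u ->
  expR (Wpot u y) = \int[P]_x expR (- a x y - Zpot u x).
Proof. by move=> bu; rewrite expR_lse//; exact: bdm_pair2 (bdm_expoW bu). Qed.

(** Both sides are the double integral of [exp (v y - a x y - Zpot u x)] against [P] and [nu], taken
    in the two orders. *)
Lemma Rintegral_expR_Zpot u v : bdm u -> bdm v ->
  \int[P]_x expR (Zpot v x - Zpot u x) = \int[nu]_y expR (v y + Wpot u y).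
Proof.
move=> bu bv.
have bg : bdm (fun p : S * T => expR (v p.2 - a p.1 p.2 - Zpot u p.1)).
  apply: bdm_expR; apply: bdmB; first exact: bdm_expo.
  by apply: bdm_fst; exact: bdm_Zpot.
transitivity (\int[P]_x \int[nu]_y expR (v y - a x y - Zpot u x)).
  apply: eq_Rintegral => x _; rewrite expRB expR_Zpot// -expRN -RintegralZr//.
    by apply: eq_Rintegral => y _; rewrite -expRD.
  exact/bdm_integrable/bdm_expR/(bdm_pair1 _ (bdm_expo bv)).
rewrite (Rintegral_fubini_tonelli _ _ bg)//.
apply: eq_Rintegral => y _; rewrite expRD expR_Wpot// -RintegralZl//.
  by apply: eq_Rintegral => x _; rewrite -expRD addrA.
exact/bdm_integrable/bdm_expR/(bdm_pair2 _ (bdm_expoW bu)).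
Qed.

Lemma Rintegral_expR_self u : bdm u ->
  \int[nu]_y expR (u y + Wpot u y) = 1.
Proof.
move=> bu; rewrite -Rintegral_expR_Zpot//.
rewrite -[RHS](Rintegral_prob_cst P); apply: eq_Rintegral => x _.
by rewrite subrr expR0.
Qed.

(** The inequality [t <= exp t - 1] at [t = Zpot v x - Zpot u x], integrated against [P]. When [v]
    is a fixed function minus [Wpot u], the right-hand side no longer depends on the marginal. *)
Lemma logpart_step u v : bdm u -> bdm v ->
  logpart v - logpart u <= \int[nu]_y expR (v y + Wpot u y) - 1.
Proof.
move=> bu bv; rewrite -Rintegral_expR_Zpot// /logpart.
rewrite -[X in _ <= _ - X](Rintegral_prob_cst P).
have bZ : bdm (fun x => Zpot v x - Zpot u x) by apply: bdmB; exact: bdm_Zpot.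
rewrite -!RintegralB//;
  [|exact/bdm_integrable/bdm_expR|exact/bdm_integrable/bdm_cst
   |exact/bdm_integrable/bdm_Zpot..].
apply: le_Rintegral => //.
- exact: bdm_integrable.
- by apply: bdm_integrable; apply: bdmB; [exact: bdm_expR|exact: bdm_cst].
- by move=> x _; rewrite lerBrDl expR_ge1Dx.
Qed.

(** The coupling has density [exp (u y - a x y - Zpot u x)] with respect to the product of [P] and
    [nu]. Integrating out [y] gives 1, so the first marginal is [P]; integrating out [x] gives the
    density of the second marginal. *)
Lemma ex_gibbs_coupling u : bdm u ->
  exists (pi : probability (S * T)%type R) (kappa : S -> probability T R),
  [/\ forall B, measurable B -> measurable_fun [set: S] (kappa ^~ B),
      forall A B, measurable A -> measurable B ->
        pi (A `*` B) = (\int[P]_(x in A) kappa x B)%E,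
      forall x, density nu (kappa x) (fun y => expR (u y - a x y - Zpot u x)) &
      forall B, measurable B ->
        pi (setT `*` B) = (\int[nu]_(y in B) (expR (u y + Wpot u y))%:E)%E].
Proof.
move=> bu; pose g (p : S * T) := expR (u p.2 - a p.1 p.2 - Zpot u p.1).
have bg : bdm g.
  apply: bdm_expR; apply: bdmB; first exact: bdm_expo.
  by apply: bdm_fst; exact: bdm_Zpot.
have g0 p : 0 <= g p by exact: expR_ge0.
have mgE : measurable_fun setT (EFin \o g) by apply/measurable_EFinP; case: bg.
have g0E p : (0 <= (EFin \o g) p)%E by rewrite lee_fin.
have gx1 x : (\int[nu]_y (g (x, y))%:E = 1)%E.
  rewrite -EFin_bdm_Rintegral; last exact: bdm_pair1 bg.
  congr EFin; rewrite -[RHS](expR0) -(subrr (Zpot u x)) expRB.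
  rewrite expR_Zpot// -[X in _ / X]expR_Zpot// -expRN -RintegralZr//.
    by apply: eq_Rintegral => y _; rewrite -expRD.
  exact/bdm_integrable/bdm_expR/(bdm_pair1 _ (bdm_expo bu)).
have g1 : (\int[P \x nu]_p (g p)%:E = 1)%E.
  rewrite (fubini_tonelli1 (EFin \o g))// /fubini_F.
  under eq_integral do rewrite /= gx1.
  by rewrite integral_cst// mul1e; exact: probability_setT.
have [pi piE] : exists pi : probability (S * T)%type R,
    density (P \x nu)%E pi g.
  by apply: ex_density_prob => //; case: bg.
have /choice[kappa kappaE] x : exists k : probability T R,
    density nu k (fun y => g (x, y)).
  by apply: ex_density_prob => //; case: (bdm_pair1 x bg).
exists pi, kappa; split => //.
- move=> B mB; 
  have -> : kappa ^~ B = fun x =>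
      fubini_F nu (fun p => (g p * \1_B p.2)%:E) x.
    apply/funext => x; case: (kappaE x) => _ _ ->//.
    rewrite /fubini_F integral_mkcond; apply: eq_integral => y _.
    by rewrite patchE indicE; case: ifP => _; rewrite ?mulr1 ?mulr0.
  apply: measurable_fun_fubini_tonelli_F.
    apply/measurable_EFinP; apply: measurable_funM; first by case: bg.
    by apply: measurableT_comp => //; exact: measurable_indic.
  by move=> p; rewrite lee_fin mulr_ge0.
- move=> A B mA mB; case: piE => _ _ ->; last exact: measurableX.
  rewrite integral_mkcond (fubini_tonelli1 _)//=; last 2 first.
  + by apply/(measurable_restrictT _ (measurableX mA mB))/measurable_funTS.
  + by move=> p; rewrite patchE; case: ifP => _ //; exact: g0E.
  rewrite [RHS]integral_mkcond; apply: eq_integral => x _; rewrite /fubini_F.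
  rewrite patchE; case: ifPn => [/set_mem xA|xA].
    case: (kappaE x) => _ _ ->//; rewrite [RHS]integral_mkcond.
    apply: eq_integral => y _; rewrite !patchE.
    by congr (if _ then _ else _); apply/idP/idP => [/set_mem[]|/set_mem] ?;
      rewrite inE.
  apply: integral0_eq => y _; rewrite patchE memNset// => -[/= + _].
  by move/mem_set; exact/negP.
- move=> B mB; case: piE => _ _ ->; last exact: measurableX.
  rewrite integral_mkcond (fubini_tonelli2 _)//=; last 2 first.
  + by apply/(measurable_restrictT _ (measurableX measurableT mB))/measurable_funTS.
  + by move=> p; rewrite patchE; case: ifP => _ //; exact: g0E.
  rewrite [RHS]integral_mkcond; apply: eq_integral => y _; rewrite /fubini_G.
  rewrite patchE; case: ifPn => [/set_mem yB|yB].
    rewrite expRD expR_Wpot// -RintegralZl//; last first.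
      exact/bdm_integrable/bdm_expR/(bdm_pair2 _ (bdm_expoW bu)).
    rewrite EFin_bdm_Rintegral; last first.
      apply: bdmZ; apply: bdm_expR; exact: bdm_pair2 (bdm_expoW bu).
    apply: eq_integral => x _; rewrite patchE mem_set//= /g/=.
    by rewrite -expRD addrA.
  apply: integral0_eq => x _; rewrite patchE memNset// => -[/= _].
  by move/mem_set; exact/negP.
Qed.

End potentials.

(** * Entropic transport and the c-transform for a single cost *)

Lemma Rintegral_marginal2 d1 d2 (S : measurableType d1) (T : measurableType d2)
    (R : realType) (pi : probability (S * T)%type R) (Q : probability T R) u :
  (forall B, measurable B -> pi (setT `*` B) = Q B) -> bdm u ->
  \int[pi]_p u p.2 = \int[Q]_y u y.
Proof.
move=> piQ bu; rewrite /Rintegral; congr fine.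
rewrite -[LHS](@integral_pushforward _ _ _ _ _ snd measurable_snd pi setT
  (EFin \o u))//; last 2 first.
- by apply/measurable_EFinP; case: bu.
- rewrite preimage_setT; apply: bdm_integrable; exact: bdm_snd.
apply: eq_measure_integral => B mB _.
apply: (etrans _ (piQ _ mB)); rewrite /= /pushforward; congr (pi _).
by apply/seteqP; split => p //= -[].
Qed.

Section entropic_transport.
Context {R : realType} {m n : nat}.
Variable leb : {measure set (Rn R n) -> \bar R}.
Variables (X : set (Rn R m)) (Y : set (Rn R n)).
Hypotheses (mX : measurable X) (mY : measurable Y).
Hypotheses (Yoo : (leb Y < +oo)%E) (Y0 : (0 < leb Y)%E).
Variable P : probability (Rn R m) R.
Hypothesis PX : P (~` X) = 0%E.
Variables (c : 'rV[R]_m -> 'rV[R]_n -> R) (eps : R).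
Hypothesis eps0 : 0 < eps.

(** The zero extension replaces the unconstrained values of [c] off the product, so that the cost
    can be bounded and measurable on the whole space and is the same at all points outside [Y]. *)
Definition scaled_cost (x : Rn R m) (y : Rn R n) : R :=
  if (x \in X) && (y \in Y) then c x y / eps else 0.

Local Notation a := scaled_cost.
Local Notation nu := (mfrestr mY Yoo).
Hypothesis ba : bdm (fun p : Rn R m * Rn R n => a p.1 p.2).

Let nu0 : (0 < nu setT)%E.
Proof. exact: mfrestr_setT_gt0. Qed.

Let bdm_dual u x : bdm u -> bdm (fun y => u y - a x y).
Proof. by move=> bu; apply: bdmB => //; exact: bdm_pair1 ba. Qed.

Let integral_scaled (mu : probability (Rn R n) R) (f : Rn R n -> R) u :
  mu (~` Y) = 0%E -> bdm u -> (forall y, Y y -> f y = eps * u y) ->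
  (\int[mu]_(y in Y) (f y)%:E = (eps * \int[mu]_y u y)%:E)%E.
Proof.
move=> muY bu fu; rewrite -RintegralZl//; last exact: bdm_integrable.
rewrite EFin_bdm_Rintegral; last exact: bdmZ.
rewrite -(integral_setC_null mY muY); last first.
  by apply/measurable_EFinP; case: (bdmZ eps bu).
by apply: eq_integral => y /set_mem/fu ->.
Qed.

(** The Gibbs principle for [h = u - a x]: the Gibbs measure realises the value, and [entr_le] shows
    that no other measure goes below it. *)
Lemma ctransE (f : 'rV[R]_n -> R) u x : bdm u -> X x ->
  (forall y, Y y -> f y = eps * u y) ->
  ctrans leb Y c eps f x = (- eps * Zpot nu a u x)%:E.
Proof.
move=> bu Xx fu; have bax : bdm (a x) by exact: bdm_pair1 ba.
have cE y : Y y -> c x y = eps * a x y.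
  by move=> Yy; rewrite /a !mem_set//= mulrC divfK ?gt_eqF.
have bh := bdm_dual x bu.
have hint (mu : probability (Rn R n) R) :
    \int[mu]_y (u y - a x y) = \int[mu]_y u y - \int[mu]_y a x y.
  by rewrite RintegralB//; exact: bdm_integrable.
apply/eqP; rewrite eq_le; apply/andP; split.
  have [mu dmu] : exists mu : probability (Rn R n) R,
      density nu mu (fun y => expR (u y - a x y - Zpot nu a u x)).
    have bg : bdm (fun y => u y - a x y - Zpot nu a u x).
      by apply: bdmB => //; exact: bdm_cst.
    apply: ex_density_prob => //; first by case: (bdm_expR bg).
    rewrite -EFin_bdm_Rintegral; last exact: bdm_expR.
    rewrite -(expR_lse nu0 bg).
    by rewrite (lseD nu0 (- Zpot nu a u x) bh) subrr expR0.
  have muY := density_mfrestr_setC dmu.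
  apply: ereal_inf_lbound; exists mu => //.
  rewrite (integral_scaled muY bax cE) (integral_scaled muY bu fu).
  rewrite -[entropy leb mu]/(entr leb mu).
  rewrite (entr_gibbs Y0 muY bh (density_of_mfrestr dmu)) hint.
  by rewrite -EFinM -!EFinB /Zpot; congr EFin; lra.
apply: le_ereal_inf_tmp => _ [mu muY <-].
rewrite (integral_scaled muY bax cE) (integral_scaled muY bu fu).
rewrite -[entropy leb mu]/(entr leb mu).
apply: (@le_trans _ _ ((eps * \int[mu]_y a x y)%:E -
  eps%:E * (Zpot nu a u x - \int[mu]_y (u y - a x y))%:E
  - (eps * \int[mu]_y u y)%:E)%E).
  by rewrite hint -EFinM -!EFinB lee_fin /Zpot; lra.
rewrite leeB// leeB// lee_wpmul2l// ?lee_fin ?(ltW eps0)//.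
exact: entr_le.
Qed.

(** Once each conditional entropy is replaced by its Gibbs bound, the transport costs cancel and the
    value depends on the coupling only through its second marginal. *)
Let coupling_value Q pi kappa u : coupling_disint P Q pi kappa -> bdm u ->
  bdm (fun x => Zpot nu a u x - \int[kappa x]_y (u y - a x y)) /\
  ((\int[pi]_(p in (X `*` Y : set (Rn R m * Rn R n)%type)) (c p.1 p.2)%:E)
   - eps%:E * (\int[P]_x (Zpot nu a u x - \int[kappa x]_y (u y - a x y))%:E)
   = (- eps * logpart P nu a u + eps * \int[Q]_y u y)%:E)%E.
Proof.
move=> [mk piE piQ] bu.
have bh : bdm (fun p : Rn R m * Rn R n => u p.2 - a p.1 p.2).
  by apply: bdmB => //; exact: bdm_snd.
have [bk intk] := Rintegral_disint mk piE bh.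
have bZ := bdm_Zpot nu0 ba bu.
have bZk : bdm (fun x => Zpot nu a u x - \int[kappa x]_y (u y - a x y)).
  exact: bdmB.
split => //.
rewrite -EFin_bdm_Rintegral// RintegralB//; [|exact: bdm_integrable..].
rewrite -intk RintegralB//; [|exact/bdm_integrable/bdm_snd|exact: bdm_integrable].
rewrite (Rintegral_marginal2 piQ bu).
have -> : (\int[pi]_(p in (X `*` Y : set (Rn R m * Rn R n)%type)) (c p.1 p.2)%:E =
    (eps * \int[pi]_p a p.1 p.2)%:E)%E.
  rewrite -RintegralZl//; last exact: bdm_integrable.
  rewrite EFin_bdm_Rintegral; last exact: bdmZ.
  rewrite integral_mkcond; apply: eq_integral => -[x y] _.
  rewrite patchE /a in_setX/=; case: ifP => _; last by rewrite mulr0.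
  by rewrite mulrC divfK ?gt_eqF.
by rewrite -EFinM -!EFinB /logpart; congr EFin; lra.
Qed.

(** Weak duality. Since [Q] does not charge the complement of [Y], the set [N] of points whose
    conditional law does charge it is null; at the other points of [X] the entropy is bounded by
    [entr_le]. *)
Lemma EOT_ge (Q : probability (Rn R n) R) u : Q (~` Y) = 0%E -> bdm u ->
  ((- eps * logpart P nu a u + eps * \int[Q]_y u y)%:E
     <= EOT leb X Y c eps P Q)%E.
Proof.
move=> QY bu; apply: le_ereal_inf_tmp => _ [pi [kappa [hpi ->]]].
have [bZk <-] := coupling_value hpi bu.
have [mk piE piQ] := hpi.
have mkY : measurable_fun setT (kappa ^~ (~` Y)) by apply: mk; exact: measurableC.
pose N := (kappa ^~ (~` Y)) @^-1` (~` [set 0%E]).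
have mN : measurable N.
  by rewrite -[N]setTI; apply: mkY => //; exact: measurableC.
have PN : P N = 0%E.
  have : (\int[P]_x `|kappa x (~` Y)| = 0)%E.
    under eq_integral do rewrite gee0_abs//.
    by rewrite -piE// ?piQ//; exact: measurableC.
  move=> /(ae_eq_integral_abs P measurableT mkY)[M [mM PM sM]].
  apply: (subset_measure0 _ mM _ PM) => // x Nx.
  by apply: sM => /= /(_ I).
rewrite leeB// lee_wpmul2l ?lee_fin ?(ltW eps0)// integral_mkcond.
apply: (@ae_le_integral_nonmeasurable _ _ _ _ _ _ (N `|` ~` X)).
- by apply: measurableU => //; exact: measurableC.
- by apply: null_set_setU => //; exact: measurableC.
- by apply/measurable_EFinP; case: bZk.
move=> x /not_orP[Nx /contrapT Xx]; rewrite patchE mem_set//.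
have kY : kappa x (~` Y) = 0%E by apply: contrapT.
rewrite -[entropy leb (kappa x)]/(entr leb (kappa x)).
by apply: entr_le => //; exact: bdm_dual.
Qed.

(** When [Q] is the second marginal of the Gibbs coupling of [u], that coupling is admissible, and
    its conditional laws attain the entropy bound used in weak duality. *)
Lemma EOT_le (Q : probability (Rn R n) R) u : bdm u ->
  density nu Q (fun y => expR (u y + Wpot P nu a u y)) ->
  (EOT leb X Y c eps P Q
     <= (- eps * logpart P nu a u + eps * \int[Q]_y u y)%:E)%E.
Proof.
move=> bu [_ _ QE].
have [pi [kappa [mk piE kE piW]]] := ex_gibbs_coupling P nu0 ba bu.
have hpi : coupling_disint P Q pi kappa.
  by split => // B mB; rewrite piW// QE.
have [bZk <-] := coupling_value hpi bu.
apply: ereal_inf_lbound; exists pi, kappa; split => //.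
congr (_ - _ * _)%E; rewrite -(integral_setC_null mX PX); last first.
  by apply/measurable_EFinP; case: bZk.
apply: eq_integral => x _; rewrite -[entropy leb (kappa x)]/(entr leb (kappa x)).
rewrite (entr_gibbs Y0 _ (bdm_dual x bu))//.
  exact: density_mfrestr_setC (kE x).
exact: density_of_mfrestr (kE x).
Qed.

End entropic_transport.

(** * Coincidence of densities with their geometric mean *)

Section geometric_mean.
Context {d} {T : measurableType d} {R : realType} {K : nat}.
Variable nu : {finite_measure set T -> \bar R}.
Variables (lam : 'I_K -> R) (t : 'I_K -> T -> R).
Hypotheses (lam0 : forall k, 0 < lam k) (lam1 : \sum_(k < K) lam k = 1).
Hypothesis bt : forall k, bdm (t k).
Hypothesis t1 : forall k, \int[nu]_y expR (t k y) = 1.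
Let w y := \sum_(k < K) lam k * t k y.
Hypothesis w1 : 1 <= \int[nu]_y expR (w y).

(* The equality case of the weighted AM-GM inequality. *)
Lemma geometric_mean_eq : \forall y \ae nu, forall k, t k y = w y.
Proof.
have bw : bdm w by apply: bdm_sum => k; exact: bdmZ.
(* The gap between the exponential and its tangent at [w y]. In the weighted sum [D] the linear
   terms cancel, because [w] is the weighted mean of the [t k]. *)
pose r k y := expR (t k y) - expR (w y) * (1 + (t k y - w y)).
have r0 k y : 0 <= r k y.
  rewrite /r -[X in expR X](subrK (w y)) expRD mulrC -mulrBr mulr_ge0 ?expR_ge0//.
  by rewrite subr_ge0 expR_ge1Dx.
have req0 k y : r k y = 0 -> t k y = w y.
  rewrite /r -[X in expR X - _](subrK (w y)) expRD mulrC -mulrBr => /eqP.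
  rewrite mulf_eq0 expR_eq0/= subr_eq0 => /eqP h.
  apply/eqP; rewrite -subr_eq0; apply: contraT => /expR_gt1Dx.
  by rewrite h ltxx.
pose D y := \sum_(k < K) lam k * r k y.
have DE y : D y = \sum_(k < K) lam k * expR (t k y) - expR (w y).
  rewrite /D /r; under eq_bigr do rewrite mulrBr mulrCA mulrDr mulr1 mulrBr.
  rewrite big_split/=; congr (_ + _).
  rewrite sumrN -mulr_sumr big_split/= sumrB lam1 -mulr_suml lam1 mul1r.
  by rewrite -/(w y) subrr addr0 mulr1.
have bD : bdm D.
  rewrite (_ : D = fun y => \sum_(k < K) lam k * expR (t k y) - expR (w y)).
    apply: bdmB; last exact: bdm_expR.
    by apply: bdm_sum => k; apply: bdmZ; exact: bdm_expR.
  by apply/funext => y; rewrite DE.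
have D0 y : 0 <= D y by apply: sumr_ge0 => k _; rewrite mulr_ge0// ltW.
(* [D] is nonnegative, while its integral is 1 minus that of [exp w], which is nonpositive by
   [w1]. *)
have intD : (\int[nu]_y `|(D y)%:E| = 0)%E.
  under eq_integral do rewrite gee0_abs ?lee_fin//.
  rewrite -EFin_bdm_Rintegral//; congr EFin.
  have intDE : \int[nu]_y D y = 1 - \int[nu]_y expR (w y).
    under eq_Rintegral do rewrite DE.
    rewrite RintegralB//; last 2 first.
    - by apply: bdm_integrable; apply: bdm_sum => k; apply: bdmZ; exact: bdm_expR.
    - exact/bdm_integrable/bdm_expR.
    congr (_ - _); rewrite -[RHS]lam1.
    have bs : forall k, bdm (fun y => lam k * expR (t k y)).
      by move=> k; apply: bdmZ; exact: bdm_expR.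
    rewrite (Rintegral_sum _ bs).
    apply: eq_bigr => k _; rewrite RintegralZl//; last exact/bdm_integrable/bdm_expR.
    by rewrite t1 mulr1.
  have : 0 <= \int[nu]_y D y by apply: Rintegral_ge0.
  by move: w1; rewrite intDE; lra.
have mD : measurable_fun setT (EFin \o D) by apply/measurable_EFinP; case: bD.
have /(ae_eq_integral_abs nu measurableT mD) := intD.
apply: filterS => y /(_ I)/= [] /eqP; rewrite psumr_eq0; last first.
  by move=> k _; rewrite mulr_ge0// ltW.
move=> /allP h k; apply: req0.
have /h/= := mem_index_enum k.
by rewrite mulf_eq0 gt_eqF//= => /eqP.
Qed.

End geometric_mean.

(** * Compactness and maximizers for equicontinuous families *)

Lemma cvg_linear_combination (R : realType) (J T : Type) (F : set_system T)
    (FF : Filter F) (l : seq J) (lam : J -> R) (g : J -> T -> R) (b : J -> R) :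
  (forall k, g k x @[x --> F] --> b k) ->
  (\sum_(k <- l) lam k * g k x) @[x --> F] --> \sum_(k <- l) lam k * b k.
Proof.
move=> gb; elim: l => [|k l IH].
  by under eq_fun do rewrite big_nil; rewrite big_nil; exact: cvg_cst.
under eq_fun do rewrite big_cons; rewrite big_cons.
by apply: cvgD => //; apply: cvgM => //; exact: cvg_cst.
Qed.

Lemma cvg_distance (R : realType) (T : Type) (F : set_system T)
    (FF : Filter F) (g h : T -> R) (a b : R) :
  g x @[x --> F] --> a -> h x @[x --> F] --> b ->
  `|g x - h x| @[x --> F] --> `|a - b|.
Proof. by move=> ga hb; apply: cvg_norm; exact: cvgB. Qed.

Lemma cvg_near_distance (R : realType) (T : Type) (F : set_system T)
    (FF : Filter F) (g : T -> R) (a : R) : g x @[x --> F] --> a ->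
  forall e, 0 < e -> \forall x \near F, `|a - g x| <= e.
Proof. by move=> /cvgr_dist_le ga e e0; exact: ga. Qed.

Lemma near_distance_cvg (R : realType) (T : Type) (F : set_system T)
    (FF : Filter F) (g : T -> R) (a : R) :
  (forall e, 0 < e -> \forall x \near F, `|a - g x| <= e) ->
  g x @[x --> F] --> a.
Proof. by move=> ga; apply/cvgrPdist_le. Qed.

Section equicontinuous_maximum.
Context {R : realType} {J : finType} {V : ptopologicalType}.
Variables (Y : set V) (y0 : V) (rho : R -> V -> V -> Prop) (M C : R).
Hypotheses (cptY : compact Y) (C0 : 0 < C).
Hypothesis rho_ge0 : forall e y y', rho e y y' -> 0 <= e.
Hypothesis rhoM : forall y y', rho M y y'.
Hypothesis rho_cont : forall e y, 0 < e -> Y y ->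
  \forall y' \near within Y (nbhs y), rho e y y'.
Hypothesis rho_out : forall y y', ~ Y y -> ~ Y y' -> rho 0 y y'.
Variable lam : J -> R.
Variable L : (J * V -> R) -> R.

(** The relation [rho e y y'] will say that the costs at [y] and [y'] differ by at most [e].
    Vanishing at [y0] fixes the additive constants and, with [rhoM], bounds the family by [2 * M].
    The factor 2 makes room for a difference of two functions with modulus [e]. Indexing by pairs
    puts the whole family in one product of real lines. *)
Definition potential_set : set (J * V -> R) := [set u |
  [/\ forall k, u (k, y0) = 0,
      forall y, \sum_k lam k * u (k, y) = 0 &
      forall k e y y', rho e y y' -> `|u (k, y) - u (k, y')| <= 2 * e]].

Hypothesis L_lip : forall u v e, potential_set u -> potential_set v ->
  (forall p, `|u p - v p| <= e) -> `|L u - L v| <= C * e.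

Local Notation W := (prod_topology (fun _ : J * V => R : topologicalType)).

(** Each condition is closed for pointwise convergence, and together they confine the values to
    [[- 2 M, 2 M]]; the set is thus closed in a Tychonoff cube. *)
Lemma compact_potential_set : compact (potential_set : set W).
Proof.
pose B : set W := [set u | forall p, `[- (2 * M), 2 * M]%classic (u p)].
have cB : compact B.
  exact: (@tychonoff _ (fun _ : J * V => R : topologicalType)
    (fun=> `[- (2 * M), 2 * M]%classic) (fun=> @segment_compact _ _ _)).
have pc (p : J * V) : continuous (fun u : W => u p).
  exact: (@proj_continuous _ (fun _ : J * V => R : topologicalType) p).
have sc (y : V) (l : seq J) :
    continuous (fun u : W => \sum_(k <- l) lam k * u (k, y) : R).
  move=> u; apply: (@cvg_linear_combination _ _ W (nbhs u) _ l lam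
    (fun k (v : W) => v (k, y)) (fun k => u (k, y))) => k; exact: pc.
have -> : potential_set = B `&` potential_set.
  apply/seteqP; split => [u [u0 us ur]|u []//]; split => // -[k y] /=.
  have := ur k M y y0 (rhoM y y0); rewrite u0 subr0 in_itv/=.
  by rewrite ler_norml.
apply: compact_closedI => //.
have -> : potential_set = (\bigcap_(k in [set: J]) [set u : W | u (k, y0) = 0])
   `&` (\bigcap_(y in [set: V]) [set u : W | \sum_k lam k * u (k, y) = 0])
   `&` (\bigcap_(q in [set q : J * R * V * V | rho q.1.1.2 q.1.2 q.2])
     [set u : W | `|u (q.1.1.1, q.1.2) - u (q.1.1.1, q.2)| <= 2 * q.1.1.2]).
  apply/seteqP; split => [u [u0 us ur]|u [[u0 us] ur]]; split => //.
  - by split => [k _|y _]; [exact: u0|exact: us].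
  - by move=> [[[k e] y] y'] /=; exact: ur.
  - by move=> k; exact: (u0 k I).
  - by move=> y; exact: (us y I).
  - by move=> k e y y' h; exact: (ur (k, e, y, y')).
apply: closedI; first apply: closedI.
- apply: closed_bigI => k _.
  apply: (@closed_comp W R (fun u : W => u (k, y0)) [set 0]) => [u _|].
    exact: pc.
  exact: closed_eq.
- apply: closed_bigI => y _.
  apply: (@closed_comp W R (fun u : W => \sum_k lam k * u (k, y)) [set 0])
    => [u _|]; last exact: closed_eq.
  exact: sc.
- apply: closed_bigI => -[[[k e] y] y'] _ /=.
  apply: (@closed_comp W R (fun u : W => `|u (k, y) - u (k, y')|)
    [set r | r <= 2 * e]); last exact: closed_le.
  move=> u _; apply: (@cvg_distance _ W (nbhs u) _ (fun v : W => v (k, y))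
    (fun v : W => v (k, y')) (u (k, y)) (u (k, y'))); exact: pc.
Qed.

(** Pointwise convergence within an equicontinuous set is uniform: on [Y] by compactness, and off
    [Y] because the functions are constant there, so that a single point controls them all. *)
Lemma near_potential_set (F : set_system (J * V -> R)) (u : J * V -> R) e :
  Filter F -> potential_set u -> F potential_set ->
  (forall p e, 0 < e -> \forall v \near F, `|u p - v p| <= e) ->
  0 < e -> \forall v \near F, forall p, `|u p - v p| <= e.
Proof.
move=> FF Su FS pc e0.
have pck y : \forall v \near F, forall k, `|u (k, y) - v (k, y)| <= e / 2.
  by apply: filter_forall => k; apply: pc; rewrite divr_gt0.
have inY : \forall v \near F,
    Y `<=` (fun y => forall k, `|u (k, y) - v (k, y)| <= e).
  move/compact_near_coveringP/near_covering_withinP : cptY; apply.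
  move=> y Yy.
  (* Moving from [y] to [y'] costs [2 * (e / 8)] for each of [u] and [v]; with [e / 2] at [y] the
     total is [e]. *)
  have e8 : 0 < e / 8 by rewrite divr_gt0.
  have := rho_cont e8 Yy; rewrite /within/= => ry.
  exists ([set y' | Y y' -> rho (e / 8) y y'],
    [set v | potential_set v /\ forall k, `|u (k, y) - v (k, y)| <= e / 2]).
    by split => //=; apply: filterI => //; exact: pck.
  move=> [y' v] /= [/[swap] -[Sv hv] hy'] Yy' k.
  have h1 := hy' Yy'; have h2 := hv k.
  case: Su => _ _ /(_ k _ _ _ h1); case: Sv => _ _ /(_ k _ _ _ h1) Hv Hu.
  move: Hv Hu h2; rewrite !ler_norml => /andP[? ?] /andP[? ?] /andP[? ?].
  by apply/andP; split; lra.
have outY : \forall v \near F,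
    forall y, ~ Y y -> forall k, `|u (k, y) - v (k, y)| <= e.
  have [[y1 Yy1]|noY] := pselect (exists y1, ~ Y y1); last first.
    by near=> v => y Yy; exfalso; apply: noY; exists y.
  near=> v => y Yy k.
  have Sv : potential_set v by near: v.
  have h2 : `|u (k, y1) - v (k, y1)| <= e / 2 by move: k; near: v; exact: pck.
  have h1 := rho_out Yy Yy1.
  case: Su => _ _ /(_ k _ _ _ h1); case: Sv => _ _ /(_ k _ _ _ h1) Hv Hu.
  move: Hv Hu h2; rewrite !ler_norml => /andP[? ?] /andP[? ?] /andP[? ?].
  by apply/andP; split; lra.
near=> v => -[k y].
have [Yy|Yy] := pselect (Y y).
  by move: k; move: y Yy; near: v.
by move: k; move: y Yy; near: v.
Unshelve. all: by end_near.
Qed.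

(** By uniform convergence, the Lipschitz functional [L] is continuous on the set for the product
    topology, and the extreme value theorem applies. *)
Lemma ex_max_potential_set : exists2 u, potential_set u &
  forall v, potential_set v -> L v <= L u.
Proof.
have S0 : potential_set !=set0.
  exists (fun=> 0); split => //.
    by move=> y; rewrite big1// => k _; rewrite mulr0.
  by move=> k e y y' /rho_ge0 e0; rewrite subrr normr0 mulr_ge0.
have Lc : {within (potential_set : set W), continuous (L : W -> R)}.
  apply/subspace_continuousP => u Su.
  apply: (@near_distance_cvg R W (within potential_set (nbhs (u : W))) _ L
    (L u)) => [|e e0]; first by apply: within_filter; exact: nbhs_filter.
  have FS : within potential_set (nbhs (u : W)) potential_set.
    by apply: (@filterE _ (nbhs (u : W)) (nbhs_filter (u : W))).
  have pc (p : J * V) r : 0 < r ->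
      \forall v \near within potential_set (nbhs (u : W)), `|u p - v p| <= r.
    move=> r0; have cp : v p @[v --> nbhs (u : W)] --> u p.
      exact: (@proj_continuous _ (fun _ : J * V => R : topologicalType) p u).
    have := cvg_near_distance (nbhs_filter (u : W)) cp r0.
    by apply: (@filterS _ _ (nbhs_filter (u : W))) => v uv _.
  have uv := near_potential_set (within_filter _ (nbhs_filter (u : W)))
    Su FS pc (divr_gt0 e0 C0).
  move: FS uv; apply: (@filterS2 _ _ (within_filter _ (nbhs_filter (u : W)))).
  by move=> v Sv /(L_lip Su Sv); rewrite mulrC divfK// gt_eqF.
have [u /set_mem Su umax] :=
  @compact_EVT_max W R L potential_set S0 compact_potential_set Lc.
by exists u => // v Sv; apply: umax; rewrite inE.
Qed.

End equicontinuous_maximum.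

(** * Borel sets, continuity and Lebesgue measure in Euclidean space *)

Section borel_Rn.
Context {R : realType} {n : nat}.
Implicit Types A : set 'rV[R]_n.

Lemma open_measurable_Rn A : open A -> measurable (A : set (Rn R n)).
Proof. exact: sub_sigma_algebra. Qed.

Lemma closed_measurable_Rn A : closed A -> measurable (A : set (Rn R n)).
Proof.
move=> cA; rewrite -[A]setCK; apply: measurableC.
by apply: open_measurable_Rn; exact: closed_openC.
Qed.

Lemma compact_closed_Rn A : compact A -> closed A.
Proof. by apply: compact_closed; exact: norm_hausdorff. Qed.

Lemma compact_measurable_Rn A : compact A -> measurable (A : set (Rn R n)).
Proof. by move/compact_closed_Rn/closed_measurable_Rn. Qed.

Lemma within_continuous_measurable_Rn A (f : 'rV[R]_n -> R) :
  closed A -> {within A, continuous f} ->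
  measurable_fun (A : set (Rn R n)) (f : Rn R n -> R).
Proof.
move=> cA /continuousP cf.
apply: (measurability _ (RGenOpens.measurableE R)).
move=> _ [_ [a [b ->] <-]].
have /open_subspaceP[V oV VA] :
    open ((f : subspace A -> R) @^-1` `]a, b[%classic).
  by apply: cf; exact: interval_open.
rewrite setIC -VA; apply: measurableI; first exact: open_measurable_Rn.
exact: closed_measurable_Rn.
Qed.

(** [is_lebesgue] prescribes the measure of boxes only, so the compact set is enclosed in a cube. *)
Lemma compact_lebesgue_lty (leb : {measure set (Rn R n) -> \bar R}) A :
  is_lebesgue leb -> compact A -> (leb A < +oo)%E.
Proof.
move=> hleb cA; have [M [_ hM]] := compact_bounded cA.
pose r := `|M| + 1.
have Mr : M < r by rewrite (le_lt_trans (ler_norm M))// ltrDl.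
have r0 : 0 <= r by rewrite addr_ge0.
pose box := [set v : Rn R n | forall i,
  (const_mx (- r) : 'rV[R]_n) ord0 i <= v ord0 i <= (const_mx r : 'rV[R]_n) ord0 i].
have mbox : measurable box.
  apply: closed_measurable_Rn.
  have -> : (box : set 'rV[R]_n) = \bigcap_(i in [set: 'I_n])
      ((fun v : 'rV[R]_n => v ord0 i) @^-1` `[- r, r]%classic).
    apply/seteqP; split => [v vb i _|v vb i].
      by have := vb i; rewrite !mxE /= in_itv.
    by have := vb i I; rewrite !mxE /= in_itv.
  apply: closed_bigI => i _; apply: closed_comp; last exact: itv_closed.
  by move=> v _; exact: coord_continuous.
apply: (@le_lt_trans _ _ (leb box)); last first.
  rewrite hleb ?ltry// => i; rewrite !mxE.
  by rewrite (le_trans _ r0)// oppr_le0.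
apply: le_measure; rewrite ?inE//; first exact: compact_measurable_Rn.
move=> v Av i; rewrite !mxE -ler_norml.
apply: (le_trans _ (hM _ Mr _ Av)).
rewrite [leRHS]/Num.norm/= mx_normrE; apply/bigmax_geP; right => /=.
by exists (ord0, i).
Qed.

Lemma within_continuous_bounded A (f : 'rV[R]_n -> R) :
  compact A -> {within A, continuous f} ->
  exists M, forall x, A x -> `|f x| <= M.
Proof.
move=> cA cf; have [M [_ hM]] := compact_bounded (continuous_compact cf cA).
exists (M + 1) => x Ax; apply: (hM (M + 1)); first by rewrite ltrDl.
by exists x.
Qed.

Lemma bdm_within_continuous A (f : 'rV[R]_n -> R) :
  compact A -> {within A, continuous f} ->
  bdm ((f : Rn R n -> R) \_ (A : set (Rn R n))).
Proof.
move=> cA cf; apply: bdm_restrict.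
- exact: compact_measurable_Rn.
- by apply: within_continuous_measurable_Rn => //; exact: compact_closed_Rn.
- exact: within_continuous_bounded.
Qed.

End borel_Rn.

(** * Boundedness, equicontinuity and measurability of the cost *)

Section cost_regularity.
Context {R : realType} {m n : nat}.
Variables (X : set 'rV[R]_m) (Y : set 'rV[R]_n).
Hypotheses (cX : compact X) (cY : compact Y).
Variable c : 'rV[R]_m -> 'rV[R]_n -> R.
Hypothesis cc : {within X `*` Y, continuous (fun p => c p.1 p.2)}.
Variables (eps : R) (eps0 : 0 < eps).

Local Notation a := (scaled_cost X Y c eps).

Lemma scaled_cost_bounded : exists M, forall x y, `|a x y| <= M.
Proof.
have cXY : compact (X `*` Y) by exact: compact_setX.
have [M [_ hM]] := compact_bounded (continuous_compact cc cXY).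
exists ((`|M| + 1) / eps) => x y; rewrite /scaled_cost.
case: ifPn => [/andP[/set_mem Xx /set_mem Yy]|_]; last first.
  by rewrite normr0 divr_ge0 ?addr_ge0// ltW.
rewrite normrM [X in _ * X]ger0_norm ?invr_ge0 ?(ltW eps0)//.
rewrite ler_wpM2r ?invr_ge0 ?(ltW eps0)//; apply: (hM (`|M| + 1)).
  by rewrite (le_lt_trans (ler_norm M))// ltrDl.
by exists (x, y).
Qed.

Let near_cost x y e : X x -> Y y -> 0 < e ->
  exists AB : set 'rV[R]_m * set 'rV[R]_n,
  [/\ nbhs x AB.1, nbhs y AB.2 & forall x' y', AB.1 x' -> AB.2 y' ->
    X x' -> Y y' -> `|c x y - c x' y'| <= e].
Proof.
move=> Xx Yy e0.
have /subspace_continuousP/(_ (x, y) (conj Xx Yy)) := cc.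
move=> /cvgr_dist_le/(_ _ e0)[[A B] /= [Ax By] AB]; exists (A, B); split => //.
by move=> x' y' Ax' By' Xx' Yy'; exact: (AB (x', y') (conj Ax' By') (conj Xx' Yy')).
Qed.

(** A tube argument: compactness of [X] makes the neighbourhood of [y] independent of [x] in [X],
    and for [x] outside [X] both values are 0. *)
Lemma scaled_cost_equicontinuous e y : 0 < e -> Y y ->
  \forall y' \near within Y (nbhs y), forall x, `|a x y - a x y'| <= e.
Proof.
move=> e0 Yy.
(* Half, because [c x' y] and [c x' y'] are both compared with [c x y]; the factor [eps] undoes the
   scaling of the cost. *)
have ee0 : 0 < eps * e / 2 by rewrite divr_gt0// mulr_gt0.
have : \forall y' \near within Y (nbhs y),
    X `<=` (fun x => `|c x y - c x y'| <= eps * e).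
  move/compact_near_coveringP/near_covering_withinP : cX; apply => x Xx.
  have [[A B] /= [Ax By AB]] := near_cost Xx Yy ee0.
  exists (A, B `&` Y) => /=.
    by split => //; apply: filterS By => y' By' Yy'.
  move=> [x' y'] /= [Ax' [By' Yy']] Xx'.
  have := AB _ _ Ax' By' Xx' Yy'.
  have := AB _ _ Ax' (nbhs_singleton By) Xx' Yy.
  rewrite /= !ler_norml => /andP[? ?] /andP[? ?].
  by apply/andP; split; lra.
move=> H; apply: (@filterS _ (nbhs y) (nbhs_filter y) _ _ _ H) => y' h Yy' x.
rewrite /scaled_cost.
rewrite !(mem_set Yy) !(mem_set Yy') !andbT.
case: ifPn => [/set_mem/(h Yy') hx|_]; last by rewrite subrr normr0 ltW.
rewrite -mulrBl normrM [X in _ * X]ger0_norm ?invr_ge0 ?(ltW eps0)//.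
by rewrite ler_pdivrMr// mulrC.
Qed.

Let scaled_cost_out x y : ~ Y y -> a x y = 0.
Proof. by move=> Yy; rewrite /scaled_cost (memNset Yy) andbF. Qed.

Let measurable_scaled_cost1 y :
  measurable_fun [set: Rn R m] (fun x : Rn R m => a x y).
Proof.
have mX : measurable (X : set (Rn R m)) by exact: compact_measurable_Rn.
have [Yy|Yy] := pselect (Y y); last first.
  rewrite (_ : (fun x => _) = cst 0); first exact: measurable_cst.
  by apply/funext => x; rewrite scaled_cost_out.
have -> : (fun x : Rn R m => a x y) =
    (fun x : Rn R m => c x y / eps) \_ (X : set (Rn R m)).
  by apply/funext => x; rewrite /scaled_cost (mem_set Yy) andbT patchE.
apply/(measurable_restrictT _ mX).
apply: measurable_funM => //.
apply: (@within_continuous_measurable_Rn _ _ X (c ^~ y)).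
  exact: compact_closed_Rn.
apply/subspace_continuousP => x Xx.
apply/cvgrPdist_le => e e0.
have [[A B] /= [Ax By AB]] := near_cost Xx Yy e0.
by apply: filterS Ax => x' Ax' Xx'; apply: AB => //; exact: nbhs_singleton By.
Qed.

(* Uniform continuity of the cost in its second argument turns a finite cover
   of Y into a measurable step function within e of the cost. *)
Let step_approximation e : 0 < e -> exists s : Rn R m * Rn R n -> R,
  measurable_fun setT s /\ forall p, `|a p.1 p.2 - s p| <= e.
Proof.
move=> e0.
have mY : measurable (Y : set (Rn R n)) by exact: compact_measurable_Rn.
have /choice[V VP] y : exists V : set 'rV[R]_n, open V /\ (Y y ->
    V y /\ forall y', V y' -> Y y' -> forall x, `|a x y - a x y'| <= e).
  have [Yy|Yy] := pselect (Y y); last by exists setT; split => //; exact: openT.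
  have := scaled_cost_equicontinuous e0 Yy; rewrite /within/= nbhsE.
  by move=> [V [oV Vy] VY]; exists V; split => // _; split.
have : cover_compact Y by rewrite -compact_cover.
move=> /(_ _ Y V)[].
- by move=> y _; have [] := VP y.
- by move=> y Yy; exists y => //; have [_ /(_ Yy)[]] := VP y.
move=> D DY YD.
(* The step function evaluates the cost at the first listed centre whose neighbourhood contains the
   second coordinate. *)
pose fix s (l : seq 'rV[R]_n) (p : Rn R m * Rn R n) {struct l} : R :=
  if l is y :: l' then (if p.2 \in V y then a p.1 y else s l' p) else 0.
have ms l : measurable_fun setT (s l).
  elim: l => [|y l IH]; first exact: measurable_cst.
  apply: measurable_fun_ifT => //.
    apply: (measurable_fun_bool true).
    rewrite (_ : _ @^-1` _ = (snd @^-1` (V y : set (Rn R n)))); last first.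
      by apply/seteqP; split => p /= => [/set_mem|/mem_set].
    apply: measurable_snd => //.
    by apply: open_measurable_Rn; have [] := VP y.
  exact: (measurableT_comp (measurable_scaled_cost1 y)).
have sP l x y : (forall z, z \in l -> Y z) -> Y y ->
    (exists2 z, z \in l & V z y) -> `|a x y - s l (x, y)| <= e.
  elim: l => [_ _ [//]|z l IH lY Yy [z' z'l Vy]] /=.
  case: ifPn => [/set_mem Vzy|/negP Vzy].
    have [_ /(_ (lY z (mem_head _ _)))[_ h]] := VP z.
    by rewrite distrC; exact: h.
  apply: IH => //; first by move=> w wl; apply: lY; rewrite inE wl orbT.
  exists z' => //; move: z'l; rewrite inE => /orP[/eqP zz'|//].
  by exfalso; apply: Vzy; apply/mem_set; rewrite -zz'.
exists (fun p => if p.2 \in Y then s (finmap.enum_fset D) p else 0); split.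
  apply: measurable_fun_ifT => //.
  apply: (measurable_fun_bool true).
  rewrite (_ : _ @^-1` _ = (snd @^-1` (Y : set (Rn R n)))); last first.
    by apply/seteqP; split => p /= => [/set_mem|/mem_set].
  exact: measurable_snd.
move=> [x y] /=; case: ifPn => [/set_mem Yy|/negP Yy].
  apply: sP => //; first by move=> z /DY/set_mem.
  by have [z zD Vzy] := YD _ Yy; exists z.
rewrite scaled_cost_out; first by rewrite subrr normr0 ltW.
by move=> ?; apply: Yy; exact/mem_set.
Qed.

(** Measurability is required for the product of the two Borel sigma-algebras; it is obtained by a
    pointwise limit of step functions with error [1 / (k + 1)]. *)
Lemma bdm_scaled_cost : bdm (fun p : Rn R m * Rn R n => a p.1 p.2).
Proof.
have [M hM] := scaled_cost_bounded.
split; last by exists M => p; exact: hM.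
have /choice[s sP] k : exists s : Rn R m * Rn R n -> R,
    measurable_fun setT s /\ forall p, `|a p.1 p.2 - s p| <= k.+1%:R^-1.
  by apply: step_approximation; rewrite invr_gt0.
apply: (@measurable_fun_cvg _ _ _ _ s); first by move=> k; have [] := sP k.
move=> p _; apply/cvgrPdist_le => e e0.
near=> k; have [_ /(_ p) h] := sP k.
apply: (le_trans h); apply: ltW; near: k.
exact: near_infty_natSinv_lt (PosNum e0).
Unshelve. all: by end_near.
Qed.

End cost_regularity.

(** * Existence of optimal dual potentials *)

Lemma ler_distB (R : realDomainType) (x x' y y' e : R) :
  `|x - x'| <= e -> `|y - y'| <= e -> `|(x - y) - (x' - y')| <= 2 * e.
Proof.
by rewrite !ler_norml => /andP[? ?] /andP[? ?]; apply/andP; split; lra.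
Qed.

Unset Implicit Arguments.

Section optimal_potentials.
Context {R : realType} {K D : nat} {Dk : 'I_K -> nat}.
Variable leb : {measure set (Rn R D) -> \bar R}.
Variables (X : forall k, set 'rV[R]_(Dk k)) (Y : set 'rV[R]_D).
Hypotheses (cX : forall k, compact (X k)) (cY : compact Y).
Hypotheses (mY : measurable (Y : set (Rn R D))) (Yoo : (leb Y < +oo)%E).
Hypothesis Y0 : (0 < leb Y)%E.
Variable P : forall k, probability (Rn R (Dk k)) R.
Variable c : forall k, 'rV[R]_(Dk k) -> 'rV[R]_D -> R.
Hypothesis cc : forall k,
  {within X k `*` Y, continuous (fun p => c k p.1 p.2)}.
Variables (lam : 'I_K -> R) (eps : R).
Hypotheses (K0 : (0 < K)%N) (lam0 : forall k, 0 < lam k).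
Hypotheses (lam1 : \sum_(k < K) lam k = 1) (eps0 : 0 < eps).

Set Implicit Arguments.

Local Notation nu := (mfrestr mY Yoo).
Local Notation a k := (scaled_cost (X k) Y (c k) eps).

Let nu0 : (0 < nu setT)%E.
Proof. exact: mfrestr_setT_gt0. Qed.

Let ba k : bdm (fun p : Rn R (Dk k) * Rn R D => a k p.1 p.2).
Proof. exact: bdm_scaled_cost. Qed.

(** The modulus of continuity common to all costs, phrased as a relation so that no supremum over
    [k] and [x] has to be formed. *)
Let rho (e : R) (y y' : 'rV[R]_D) : Prop :=
  forall k (x : Rn R (Dk k)), `|a k x y - a k x y'| <= e.

Let rho_ge0 e y y' : rho e y y' -> 0 <= e.
Proof. by move=> /(_ (Ordinal K0) (0 : 'rV[R]_(Dk (Ordinal K0)))); exact: le_trans. Qed.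

Let ex_rho_bound : exists M, forall y y', rho M y y'.
Proof.
have /choice[M hM] k := scaled_cost_bounded (cX k) cY (cc k) eps0.
have M0 k : 0 <= M k by exact: le_trans (hM k (0 : 'rV[R]_(Dk k)) (0 : 'rV[R]_D)).
exists (\sum_(k < K) (M k + M k)) => y y' k x.
apply: (le_trans (ler_normB _ _)); rewrite (bigD1 k)//=.
rewrite (le_trans (lerD (hM k x y) (hM k x y')))// lerDl.
by apply: sumr_ge0 => j _; rewrite addr_ge0.
Qed.

Let rho_near e y : 0 < e -> Y y ->
  \forall y' \near within Y (nbhs y), rho e y y'.
Proof.
move=> e0 Yy; apply: filter_forall => k.
exact: (scaled_cost_equicontinuous (cX k) (cc k) eps0).
Qed.

Let rho_out y y' : ~ Y y -> ~ Y y' -> rho 0 y y'.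
Proof.
by move=> Yy Yy' k x; rewrite /scaled_cost (memNset Yy) (memNset Yy') andbF subrr normr0.
Qed.

Let rho_continuous (f : 'rV[R]_D -> R) :
  (forall e y y', rho e y y' -> `|f y - f y'| <= 2 * e) ->
  {within Y, continuous f}.
Proof.
move=> fr; apply/subspace_continuousP => y Yy; apply/cvgrPdist_le => e e0.
have e2 : 0 < e / 2 by rewrite divr_gt0.
apply: (@filterS _ (nbhs y) (nbhs_filter y) _ _ _ (rho_near e2 Yy)) => y' h Yy'.
by have := fr _ _ _ (h Yy'); rewrite mulrC divfK.
Qed.

(** On [Y] the function is continuous. Off [Y] any two points are related by [rho 0], so it is
    constant there. *)
Let rho_bdm (f : 'rV[R]_D -> R) :
  (forall e y y', rho e y y' -> `|f y - f y'| <= 2 * e) ->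
  bdm (f : Rn R D -> R).
Proof.
move=> fr; have cf := rho_continuous fr.
have mf : measurable_fun (Y : set (Rn R D)) (f : Rn R D -> R).
  by apply: within_continuous_measurable_Rn => //; exact: compact_closed_Rn.
split; last first.
  have [M hM] := ex_rho_bound; exists (`|f 0| + 2 * M) => y.
  rewrite -lerBlDl (le_trans (lerB_dist _ _))//; exact: fr.
rewrite -[setT](setUv (Y : set (Rn R D))).
apply/measurable_funU => //; first exact: measurableC.
split => //.
have [[y1 Yy1]|noY] := pselect (exists y1, ~ Y y1); last first.
  rewrite (_ : ~` _ = set0); first exact: measurable_fun_set0.
  by apply/seteqP; split => // y Yy; apply: noY; exists y.
apply: (eq_measurable_fun (cst (f y1))); last exact: measurable_cst.
move=> y /set_mem Yy; have := fr _ _ _ (rho_out Yy1 Yy).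
by rewrite mulr0 normr_le0 subr_eq0 => /eqP.
Qed.

(** The last inequality expresses maximality: the step from [u] to [w - W k] gains at least 1 minus
    the integral of [exp w], and this gain cannot be positive. *)
Lemma ex_optimal_potentials : exists u : 'I_K -> 'rV[R]_D -> R,
  [/\ forall k, bdm (u k : Rn R D -> R),
      forall k, {within Y, continuous (u k)},
      forall y, \sum_(k < K) lam k * u k y = 0 &
      1 <= \int[nu]_y expR (\sum_(k < K)
             lam k * (u k y + Wpot (P k) nu (a k) (u k : Rn R D -> R) y))].
Proof.
have [M rhoM] := ex_rho_bound.
pose y0 : 'rV[R]_D := 0.
pose J k (f : Rn R D -> R) := logpart (P k) nu (a k) f.
(* The dual value of the potentials [eps * u], divided by [eps]. *)
pose L (u : 'I_K * 'rV[R]_D -> R) := - \sum_(k < K) lam k * J k (fun y => u (k, y)).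
have Sb u k : potential_set y0 rho lam u -> bdm ((fun y => u (k, y)) : Rn R D -> R).
  by move=> [_ _ ur]; apply: rho_bdm; exact: ur.
have L_lip u v e : potential_set y0 rho lam u -> potential_set y0 rho lam v ->
    (forall p, `|u p - v p| <= e) -> `|L u - L v| <= 1 * e.
  move=> Su Sv uv.
  have -> : L u - L v =
      \sum_(k < K) lam k * (J k (fun y => v (k, y)) - J k (fun y => u (k, y))).
    by under [RHS]eq_bigr do rewrite mulrBr; rewrite sumrB /L opprK addrC.
  apply: (le_trans (ler_norm_sum _ _ _)).
  rewrite -lam1 mulr_suml; apply: ler_sum => k _.
  rewrite normrM gtr0_norm// ler_pM2l// distrC.
  by apply: logpart_dist => //; [exact: Sb|exact: Sb].
have [u Su umax] := ex_max_potential_set cY ltr01 rho_ge0 rhoM rho_near rho_out L_lip.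
have [_ usum ur] := Su.
pose f k : Rn R D -> R := fun y => u (k, y).
have bf k : bdm (f k) by exact: Sb.
pose W k := Wpot (P k) nu (a k) (f k).
have bW k : bdm (W k) by exact: bdm_Wpot.
pose w y := \sum_(k < K) lam k * W k y.
have bw : bdm w by apply: bdm_sum => k; exact: bdmZ.
(* The Sinkhorn-like step: [q k + W k] is the same function [w] for all [k], and the weighted sum of
   the [q k] vanishes because the weights sum to one. *)
pose q k y := w y - W k y.
have bq k : bdm (q k) by exact: bdmB.
have qsum y : \sum_(k < K) lam k * q k y = 0.
  rewrite /q; under eq_bigr do rewrite mulrBr.
  by rewrite sumrB -mulr_suml lam1 mul1r subrr.
have Wr k e y y' : rho e y y' -> `|W k y - W k y'| <= e.
  by move=> h; apply: Wpot_dist => // x; exact: h.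
have qr k e y y' : rho e y y' -> `|q k y - q k y'| <= 2 * e.
  move=> h; have hw : `|w y - w y'| <= e.
    rewrite /w -sumrB; apply: (le_trans (ler_norm_sum _ _ _)).
    rewrite -[leRHS]mul1r -lam1 mulr_suml; apply: ler_sum => j _.
    by rewrite -mulrBr normrM gtr0_norm// ler_pM2l// Wr.
  exact: (ler_distB hw (Wr k _ _ _ h)).
have step k : J k (q k) - J k (f k) <= \int[nu]_y expR (w y) - 1.
  apply: (le_trans (logpart_step (P k) nu0 (ba k) (bf k) (bq k))).
  by under eq_Rintegral do rewrite subrK.
have wE : \int[nu]_y expR (\sum_(k < K) lam k * (u (k, y) + W k y)) =
    \int[nu]_y expR (w y).
  apply: eq_Rintegral => y _; congr expR; under eq_bigr do rewrite mulrDr.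
  by rewrite big_split/= usum add0r.
exists (fun k y => u (k, y)); split => //.
  by move=> k; apply: rho_continuous; exact: ur.
rewrite wE; clear wE Wr; move: step qsum qr bq; clearbody q => step qsum qr bq.
(* Normalisation at [y0] puts the step back into the compact set. It leaves [L] unchanged, since the
   subtracted constants have weighted sum 0. *)
pose v (p : 'I_K * 'rV[R]_D) := q p.1 p.2 - q p.1 y0.
have Sv : potential_set y0 rho lam v.
  split => [k|y|k e y y' h]; rewrite /v/=.
  - by rewrite subrr.
  - transitivity (\sum_(k < K) lam k * q k y - \sum_(k < K) lam k * q k y0).
      by rewrite -sumrB; apply: eq_bigr => k _; rewrite mulrBr.
    by rewrite (qsum y) (qsum y0) subrr.
  - by rewrite opprB addrA subrK; exact: qr.
have Jv k : J k (fun y => v (k, y)) = J k (q k) - q k y0.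
  exact: (logpartD _ nu0 (ba k) (- q k y0) (bq k)).
have := umax _ Sv; rewrite /L lerN2.
under [X in _ <= X -> _]eq_bigr do rewrite Jv mulrBr.
rewrite sumrB qsum subr0 -subr_ge0 -sumrB => h.
rewrite -subr_ge0 (le_trans h)//.
rewrite -[leRHS]mul1r -[X in _ <= X * _]lam1 mulr_suml; apply: ler_sum => k _.
by rewrite -mulrBr ler_pM2l//; exact: step.
Qed.

End optimal_potentials.

(** * Strong duality for the barycenter problem *)

Theorem theorem1 (R : realType) (K : nat) (hK : (0 < K)%N)
  (Dk : 'I_K -> nat) (D : nat)
  (leb : forall n : nat, {measure set (Rn R n) -> \bar R})
  (hleb : forall n : nat, is_lebesgue (leb n))
  (X : forall k : 'I_K, set 'rV[R]_(Dk k))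
  (hX : forall k : 'I_K, compact (X k))
  (Y : set 'rV[R]_D) (hY : compact Y) (hYpos : (0 < leb D Y)%E)
  (P : forall k : 'I_K, probability (Rn R (Dk k)) R)
  (hPX : forall k : 'I_K, P k (~` X k) = 0%E)
  (hPac : forall k : 'I_K, P k `<< leb (Dk k))
  (c : forall k : 'I_K, 'rV[R]_(Dk k) -> 'rV[R]_D -> R)
  (hc : forall k : 'I_K, {within X k `*` Y, continuous (fun p => c k p.1 p.2)})
  (lam : 'I_K -> R) (hlam : forall k, 0 < lam k) (hlam1 : \sum_(k < K) lam k = 1)
  (eps : R) (heps : 0 < eps)
  (hfin : exists Q : probability (Rn R D) R, Q (~` Y) = 0%E /\
     (\sum_(k < K) (lam k)%:E * EOT (leb D) (X k) Y (c k) eps (P k) Q)%E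
       \is a fin_num) :
  ereal_inf [set (\sum_(k < K) (lam k)%:E * EOT (leb D) (X k) Y (c k) eps (P k) Q)%E
            | Q in [set Q : probability (Rn R D) R | Q (~` Y) = 0%E]]
  = ereal_sup [set (\sum_(k < K) (lam k)%:E *
                     \int[P k]_(x in X k) ctrans (leb D) Y (c k) eps (f k) x)%E
              | f in [set f : 'I_K -> 'rV[R]_D -> R |
                       (forall k, {within Y, continuous (f k)}) /\
                       (forall y, Y y -> \sum_(k < K) lam k * f k y = 0)]].
Proof.
have mY : measurable (Y : set (Rn R D)) by exact: compact_measurable_Rn.
have Yoo : (leb D Y < +oo)%E by exact: compact_lebesgue_lty.
have mX k : measurable (X k : set (Rn R (Dk k))).
  exact: compact_measurable_Rn.
pose nu := mfrestr mY Yoo.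
pose a k := scaled_cost (X k) Y (c k) eps.
have ba k : bdm (fun p : Rn R (Dk k) * Rn R D => a k p.1 p.2).
  exact: (bdm_scaled_cost (hX k) hY (hc k) heps).
have nu0 : (0 < nu setT)%E by exact: mfrestr_setT_gt0.
pose J k (u : Rn R D -> R) := logpart (P k) nu (a k) u.
have ctr f u k : bdm (u : Rn R D -> R) -> (forall y, Y y -> f y = eps * u y) ->
    (\int[P k]_(x in X k) ctrans (leb D) Y (c k) eps f x = (- eps * J k u)%:E)%E.
  move=> bu fu.
  have bZ := bdmZ (- eps) (bdm_Zpot nu0 (ba k) bu).
  rewrite -RintegralZl//; last exact/bdm_integrable/bdm_Zpot.
  rewrite EFin_bdm_Rintegral//.
  rewrite -(integral_setC_null (mX k) (hPX k)); last first.
    by apply/measurable_EFinP; case: bZ.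
  apply: eq_integral => x /set_mem Xx.
  exact: (ctransE mY Yoo hYpos heps (ba k) bu Xx fu).
(* The integrals against [Q] drop out: their weighted sum is the integral of the constraint, which
   vanishes on [Y], and [Q] is carried by [Y]. *)
have lincomb (u : 'I_K -> Rn R D -> R) (Q : probability (Rn R D) R) :
    (forall k, bdm (u k)) -> Q (~` Y) = 0%E ->
    (forall y, Y y -> \sum_(k < K) lam k * u k y = 0) ->
    \sum_(k < K) lam k * (- eps * J k (u k) + eps * \int[Q]_y u k y) =
    \sum_(k < K) lam k * (- eps * J k (u k)).
  move=> bu QY usum; under eq_bigr do rewrite mulrDr; rewrite big_split/=.
  suff -> : \sum_(k < K) lam k * (eps * \int[Q]_y u k y) = 0 by rewrite addr0.
  have blu k : bdm (fun y => lam k * u k y) by exact: bdmZ.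
  transitivity (eps * \int[Q]_y (\sum_(k < K) lam k * u k y)).
    rewrite (Rintegral_sum _ blu) mulr_sumr; apply: eq_bigr => k _.
    rewrite [LHS]mulrCA; congr (_ * _); apply: esym.
    by apply: RintegralZl => //; exact: (bdm_integrable Q (bu k)).
  rewrite /Rintegral -(integral_setC_null mY QY); last first.
    by apply/measurable_EFinP; case: (bdm_sum blu).
  rewrite integral0_eq ?mulr0//.
  by move=> y Yy; rewrite usum.
apply/eqP; rewrite eq_le; apply/andP; split.
  (* The infimum is at most the supremum: optimal potentials produce an admissible [Q] without
     duality gap. *)
  have [u [bu cu usum u1]] := ex_optimal_potentials hX hY mY Yoo hYpos P hc
    hK hlam hlam1 heps.
  pose W k := Wpot (P k) nu (a k) (u k : Rn R D -> R).
  have bW k : bdm (W k) by exact: bdm_Wpot.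
  have bt k : bdm (fun y : Rn R D => u k y + W k y) by exact: bdmD.
  have int1 k : \int[nu]_y expR (u k y + W k y) = 1.
    exact: Rintegral_expR_self.
  have tE := geometric_mean_eq hlam hlam1 bt int1 u1.
  pose w (y : Rn R D) := \sum_(k < K) lam k * (u k y + W k y).
  have bw : bdm w by apply: bdm_sum => k; exact: bdmZ.
  have dens k (mu : probability (Rn R D) R) : density nu mu (fun y => expR (w y)) ->
      density nu mu (fun y => expR (u k y + W k y)).
    move=> [mw w0 wE]; have [mt _] := bdm_expR (bt k).
    split => // B mB.
    rewrite wE//; apply: ae_eq_integral => //.
    - by apply/measurable_EFinP; exact: measurable_funTS.
    - by apply/measurable_EFinP; exact: measurable_funTS.
    - by apply: filterS tE => y /(_ k) ty _; rewrite ty.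
  (* The common second marginal of the Gibbs couplings. Its mass is one because [exp w] agrees
     almost everywhere with any one of the marginal densities; [hK] supplies an index. *)
  have [Q dQ] : exists Q : probability (Rn R D) R,
      density nu Q (fun y => expR (w y)).
    have bew := bdm_expR bw.
    apply: ex_density_prob; [by case: bew|by move=> y; exact: expR_ge0|].
    rewrite -EFin_bdm_Rintegral// -[in RHS](int1 (Ordinal hK)).
    rewrite !EFin_bdm_Rintegral//; last exact: bdm_expR.
    apply: ae_eq_integral => //.
    - by apply/measurable_EFinP; case: bew.
    - by apply/measurable_EFinP; case: (bdm_expR (bt (Ordinal hK))).
    - by apply: filterS tE => y /(_ (Ordinal hK)) ty _; rewrite ty.
  have QY : Q (~` Y) = 0%E by exact: density_mfrestr_setC dQ.
  apply: (@le_trans _ _ (\sum_(k < K) (lam k)%:E *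
      EOT (leb D) (X k) Y (c k) eps (P k) Q)%E).
    by apply: ereal_inf_lbound; exists Q.
  apply: (@le_trans _ _ (\sum_(k < K) (lam k)%:E *
      (- eps * J k (u k) + eps * \int[Q]_y u k y)%:E)%E).
    apply: lee_sum => k _; apply: lee_wpmul2l; first by rewrite lee_fin ltW.
    exact: (EOT_le (mX k) hYpos (hPX k) heps (ba k) (bu k) (dens k Q dQ)).
  under eq_bigr do rewrite -EFinM.
  rewrite sumEFin (lincomb _ _ bu QY)//.
  (* Scaling back by [eps] turns the optimal [u] into an admissible family whose dual value is the
     bound just reached. *)
  apply: ereal_sup_ubound; exists (fun k y => eps * u k y).
    split => [k|y Yy].
      apply/subspace_continuousP => y Yy; apply: cvgM; first exact: cvg_cst.
      by have /subspace_continuousP/(_ y Yy) := cu k.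
    by under eq_bigr do rewrite mulrCA; rewrite -mulr_sumr usum mulr0.
  rewrite -sumEFin; apply: eq_bigr => k _.
  by rewrite (ctr _ (u k)).
(* The supremum is at most the infimum: weak duality for an arbitrary family [f] and an arbitrary
   [Q]. *)
apply: ge_ereal_sup => _ [f [cf fsum] <-].
apply: le_ereal_inf_tmp => _ [Q QY <-].
(* Continuity of [f k] is available on [Y] only; the cut-off makes the scaled potential bounded and
   measurable everywhere and preserves its values on [Y]. *)
pose u k : Rn R D -> R := fun y => eps^-1 * ((f k : Rn R D -> R) \_ (Y : set (Rn R D))) y.
have bu k : bdm (u k) by apply: bdmZ; exact: bdm_within_continuous.
have fu k y : Y y -> f k y = eps * u k y.
  by move=> Yy; rewrite /u patchE mem_set// mulrA divff ?mul1r// gt_eqF.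
have usum y : Y y -> \sum_(k < K) lam k * u k y = 0.
  move=> Yy; transitivity (eps^-1 * \sum_(k < K) lam k * f k y); last first.
    by rewrite fsum// mulr0.
  rewrite mulr_sumr; apply: eq_bigr => k _.
  by rewrite /u patchE mem_set// mulrCA.
apply: (@le_trans _ _ (\sum_(k < K) (lam k)%:E *
    (- eps * J k (u k) + eps * \int[Q]_y u k y)%:E)%E).
  under [leRHS]eq_bigr do rewrite -EFinM.
  rewrite sumEFin (lincomb _ _ bu QY usum) -sumEFin.
  by apply: lee_sum => k _; rewrite EFinM (ctr _ _ _ (bu k) (fu k)).
apply: lee_sum => k _; apply: lee_wpmul2l; first by rewrite lee_fin ltW.
exact: (EOT_ge (mX k) mY Yoo hYpos (hPX k) heps (ba k) QY (bu k)).
Qed.
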